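(* Let $p$ be a positive integer and let $n_1,\ldots,n_p$ and $k_1,\ldots,k_p$ be positive integers satisfying $n_i\ge 2k_i$ for all $i\in[p]$. Let $X=\prod_{i\in[p]}\binom{[n_i]}{k_i}$ and let $\mathcal{A}_1,\mathcal{A}_2,\ldots,\mathcal{A}_m\subseteq X$ be cross-intersecting families with $\mathcal{A}_1\ne\emptyset$. Then $$\sum_{i=1}^{m}|\mathcal{A}_i|\le \begin{cases}|X|, & \text{if } m\le \min_{i\in[p]}\frac{n_i}{k_i};\\ m\cdot M, & \text{if } m\ge \min_{i\in[p]}\frac{n_i}{k_i},\end{cases}$$ where $M=\max_{i\in[p]}\binom{n_i-1}{k_i-1}\prod_{j\neq i}\binom{n_j}{k_j}$. Furthermore, the bound is attained if and only if one of the following holds: (i) $m<\min_{i\in[p]}\frac{n_i}{k_i}$ and $\mathcal{A}_1=X$, $\mathcal{A}_2=\cdots=\mathcal{A}_m=\emptyset$; (ii) $m>\min_{i\in[p]}\frac{n_i}{k_i}$ and $\mathcal{A}_1=\cdots=\mathcal{A}_m=I$, where $I$ is a maximum intersecting family in $X$; (iii) $m=\min_{i\in[p]}\frac{n_i}{k_i}$ and one of the following holds: $\mathcal{A}_1=X$ and $\mathcal{A}_2=\cdots=\mathcal{A}_m=\emptyset$; or $\mathcal{A}_1=\cdots=\mathcal{A}_m=I$ for a maximum intersecting family $I$ in $X$; or there exist a non-empty set $S_1\subseteq\{s\in[p]:\frac{n_s}{k_s}=2\}$ and, with $\mathcal{F}=\prod_{s\in S_1}\binom{[n_s]}{k_s}$,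 families $\mathcal{A},\mathcal{E},\mathcal{E}'\subseteq\mathcal{F}$ such that $$\mathcal{A}_1=\bigl(\mathcal{A}\sqcup(\mathcal{E}\cup\mathcal{E}_{\mathcal{F}})\bigr)\times\prod_{s\in[p]\setminus S_1}\binom{[n_s]}{k_s}\quad\text{and}\quad \mathcal{A}_2=\bigl(\mathcal{A}\sqcup(\mathcal{E}'\cup\mathcal{E}'_{\mathcal{F}})\bigr)\times\prod_{s\in[p]\setminus S_1}\binom{[n_s]}{k_s},$$ where $\mathcal{A}=\{A_1,\ldots,A_{w_0}\}$ satisfies $2w_0<|\mathcal{F}|$ and $A_i\ne\bar{A}_j$ for all $i\ne j\in[w_0]$, and where $\mathcal{E}\sqcup\mathcal{E}'=\{E_1,\ldots,E_v\}$ and $\mathcal{E}_{\mathcal{F}}\sqcup\mathcal{E}'_{\mathcal{F}}=\{\bar{E}_1,\ldots,\bar{E}_v\}$ satisfy $2(v+w_0)=\prod_{s\in S_1}\binom{n_s}{k_s}$ and $\bigsqcup_{j=1}^{v}\{E_j,\bar{E}_j\}=\mathcal{F}\setminus(\mathcal{A}\sqcup\mathcal{A}_{\mathcal{F}})$.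
   Context: $[n]=\{1,\ldots,n\}$, and $\binom{[n]}{k}$ is the family of all $k$-element subsets of $[n]$. The symbol $\sqcup$ denotes disjoint union. Multi-part families: the ground set is a disjoint union of $p$ parts, the $i$-th part being a copy of $[n_i]$. For $S\subseteq[p]$, $\prod_{i\in S}\binom{[n_i]}{k_i}$ denotes the family of all sets $A=\bigsqcup_{i\in S}A_i$ (also written $\prod_{i\in S}A_i$) having exactly $k_i$ elements in the $i$-th part for each $i\in S$ (so $A_i\in\binom{[n_i]}{k_i}$). More generally, for families $\mathcal{F}_i$ of subsets of the $i$-th part, $\prod_i\mathcal{F}_i=\{\bigsqcup_i A_i: A_i\in\mathcal{F}_i\}$; the product $\times$ of families on disjoint collections of parts is defined in the same way. Two such sets $A,B$ intersect if $A_i\cap B_i\ne\emptyset$ for at least one part $i$, and $A\cap B=\emptyset$ means $A_i\cap B_i=\emptyset$ for all parts $i$. A family $\mathcal{G}\subseteq X$ is intersecting if $A\cap B\ne\emptyset$ for all $A,B\in\mathcal{G}$; a maximum intersecting family in $X$ is one of largest cardinality. Families $\mathcal{A}_1,\ldots,\mathcal{A}_m$ are cross-intersecting if $A\cap B\ne\emptyset$ for all $A\in\mathcal{A}_i$, $B\in\mathcal{A}_j$, $i\ne j$. For $A=\prod_{s\in S}A_s\in\prod_{s\in S}\binom{[n_s]}{k_s}$, $\bar{A}=\prod_{s\in S}\bar{A}_s$, where $\bar{A}_s=[n_s]\setminus A_s$. For a family $\mathcal{F}$ and a subfamily $\mathcal{C}\subseteq\mathcal{F}$, $\mathcal{C}_{\mathcal{F}}=\{B\in\mathcal{F}: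 A\cap B=\emptyset\text{ for some }A\in\mathcal{C}\}$. *)

(* Defs.v *)
From mathcomp Require Import all_boot all_order all_algebra.

Set Implicit Arguments.
Unset Strict Implicit.
Unset Printing Implicit Defensive.

Import Order.TTheory GRing.Theory Num.Theory.

(* Indices are 0-based: [p] is 'I_p and the i-th part is a copy of 'I_(n i).
   The ground set is the disjoint union of the parts, so the multi-part set
   A = \bigsqcup_i A_i is a plain {set ground n}, and the intersection of two
   such sets, taken part by part, is the ordinary :&:. *)
Notation ground n := {i : 'I__ & 'I_(n i)}.

Section SetFamilies.

Context {T : finType}.
Implicit Types (A B : {set T}) (F G X C : {set {set T}}).

(* A and B are allowed to coincide, so set0 is in no intersecting family. *)
Definition intersecting G : Prop :=
  forall A B, A \in G -> B \in G -> A :&: B != set0.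

Definition max_intersecting X (I : {set {set T}}) : Prop :=
  [/\ I \subset X, intersecting I &
      forall G, G \subset X -> intersecting G -> #|G| <= #|I|].

Definition cross_intersecting m (Fs : 'I_m -> {set {set T}}) : Prop :=
  forall i j, i != j ->
  forall A B, A \in Fs i -> B \in Fs j -> A :&: B != set0.

(* The family written C_F, for C a subfamily of F. *)
Definition disj_nbhd F C : {set {set T}} :=
  [set B in F | [exists A in C, A :&: B == set0]].

(* The product of families living on disjoint collections of parts. *)
Definition fam_prod F G : {set {set T}} := [set A :|: B | A in F, B in G].

(* C is the disjoint union of F and G. *)
Definition is_dunion C F G : Prop := [disjoint F & G] /\ C = F :|: G.

End SetFamilies.

Section MultiPart.

Context {p : nat}.
Implicit Types (n k : 'I_p -> nat) (S : {set 'I_p}).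

Definition part n (A : {set ground n}) (i : 'I_p) : {set 'I_(n i)} :=
  [set x | Tagged (fun j => 'I_(n j)) x \in A].

(* \prod_(i in S) binom([n_i], k_i); its members are empty outside S. *)
Definition layers n k S : {set {set ground n}} :=
  [set A | [forall i, #|part A i| == (if i \in S then k i else 0)]].

(* The complement of A inside the parts indexed by S only. *)
Definition compl_in n S (A : {set ground n}) : {set ground n} :=
  [set x | (tag x \in S) && (x \notin A)].

Definition part_ratio n k (i : 'I_p) : rat := ((n i)%:R / (k i)%:R)%R.

(* The default value of the iterated minimum is itself one of the ratios. *)
Definition min_ratio n k (hp : 0 < p) : rat :=
  \big[Num.min/part_ratio n k (Ordinal hp)]_(i < p) part_ratio n k i.

Definition max_star n k : nat :=
  \max_(i < p) ('C(n i - 1, k i - 1) * \prod_(j < p | j != i) 'C(n j, k j)).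

(* The third extremal configuration for m = min_i n_i / k_i, in terms of the
   first two families B1 and B2. Here w and v are the sizes of A and of the
   disjoint union of E and E', enumerated without repetition by a and e. *)
Definition paired_config n k (B1 B2 : {set {set ground n}}) : Prop :=
  exists S1 : {set 'I_p},
  [/\ S1 != set0, S1 \subset [set s | part_ratio n k s == 2%:R%R] &
  let F := layers n k S1 in
  let R := layers n k (~: S1) in
  exists A E E' : {set {set ground n}},
  [/\ [/\ A \subset F, E \subset F & E' \subset F],
      exists2 D1, is_dunion D1 A (E :|: disj_nbhd F E) & B1 = fam_prod D1 R,
      exists2 D2, is_dunion D2 A (E' :|: disj_nbhd F E') & B2 = fam_prod D2 R &
  exists (w v : nat) (a : 'I_w -> {set ground n}) (e : 'I_v -> {set ground n}),
  [/\ injective a /\ A = [set a i | i : 'I_w],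
      2 * w < #|F| /\ (forall i j, i != j -> a i != compl_in S1 (a j)),
      [/\ injective e,
          is_dunion [set e j | j : 'I_v] E E' &
          is_dunion [set compl_in S1 (e j) | j : 'I_v]
                    (disj_nbhd F E) (disj_nbhd F E')],
      2 * (v + w) = \prod_(s in S1) 'C(n s, k s) &
      [/\ forall j, e j != compl_in S1 (e j),
          forall i j, i != j -> [disjoint [set e i; compl_in S1 (e i)]
                                        & [set e j; compl_in S1 (e j)]] &
          exists2 D, is_dunion D A (disj_nbhd F A) &
          \bigcup_(j < v) [set e j; compl_in S1 (e j)] = F :\: D]]]].

End MultiPart.

(* Main.v *)
Require Import Defs.
From mathcomp Require Import all_boot all_order all_algebra all_fingroup.
From mathcomp Require Import zify.

(** Let N = n i0 and K = k i0 for a part i0 with the smallest ratio n i / k i.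
    The proof maps a cycle of length N, whose points x and y are adjacent when
    their circular distance is at least K, into the disjointness graph on the
    layer X: the point x goes to the set [arcs x], which is in every part i an
    arc of length k i starting at position x * n i / N, rounded down. Because
    the ratio of i0 is the smallest, adjacent points go to disjoint sets. The
    permutations of the ground set that preserve the parts act transitively on
    X, and even on ordered pairs of disjoint members of X. Averaging over the
    symmetric copies of the cycle ([averaging]) therefore reduces inequalities
    on X to inequalities on the cycle, and equality on X means equality on
    each copy.

    Let U be the union of the families, I the core of U (the members that meet
    all of U) and Y the rest. A member of Y lies in one family only, so
    the sum of the sizes is at most #|Y| + m * #|I|. Katona's pairing on the
    cycle ([cycle_bound]) gives K * #|Y| + N * #|I| <= K * #|X|
    ([weighted_bound]). Comparing m with N / K yields both bounds, since
    N * M = K * #|X| ([max_starE]); the case of empty Y shows that M is the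
    largest size of an intersecting family, which stars attain.

    In the case of equality, m < N / K forces I to be empty, and m > N / K
    forces Y to be empty. If m = N / K >= 3, then 2 K < N, and a copy of the
    cycle on which equality holds lies in Y or misses Y; as every disjoint pair
    occurs on some copy, Y is closed under disjointness ([weighted_eq_closed]).
    The disjointness graph is connected in this case, because exchanging one
    point of a part with n i > 2 k i takes two disjointness steps
    ([two_step_closed]); so Y is empty or all of X. If m = N / K = 2, the
    antipodal pairs x, x + K show that equality holds exactly when, for
    disjoint B and C in X, exactly one of B in A_1 and C in A_2 is true
    ([cross_pair_bound]). The two families are then determined by their traces
    on the parts with n i = 2 k i, where disjointness is complementation, and
    sorting complementary pairs gives the paired configuration
    ([half_equality]). *)

Set Implicit Arguments.
Unset Strict Implicit.
Unset Printing Implicit Defensive.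

Import Order.TTheory GRing.Theory Num.Theory.

(** * Circular arcs *)

Lemma sum_periodic (f : nat -> nat) N a : (forall x, f (x + N) = f x) ->
  \sum_(a <= x < a + N) f x = \sum_(0 <= x < N) f x.
Proof.
move=> fN; elim: a => [//|a IHa]; rewrite -IHa.
case: N fN {IHa} => [|N] fN; first by rewrite addn0 !big_geq ?addn0.
rewrite addSn big_nat_recr /=; last by lia.
by rewrite [RHS]big_ltn ?fN 1?addnC //; lia.
Qed.

(** Katona's pairing argument on the cycle of length N, where x and y are
    adjacent when their circular distance is at least K. Besides a itself,
    the points not adjacent to a are those at distance less than K, and they
    split into K - 1 pairs of points at distance exactly K. Giving a point
    of I weight 2 and a point of Y weight 1, each pair weighs at most 2: a
    member of I excludes its partner from I and from Y. *)
Lemma cycle_bound (I Y : pred nat) N K a :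
    0 < K -> 2 * K <= N ->
    (forall x, I (x + N) = I x) -> (forall x, Y (x + N) = Y x) ->
    (forall x, I x -> ~~ Y x) ->
    (forall x d, I x -> K <= d <= N - K -> ~~ I (x + d) && ~~ Y (x + d)) ->
    I a ->
  2 * (\sum_(0 <= x < N) I x) + \sum_(0 <= x < N) Y x <= 2 * K.
Proof.
move=> K0 KN perI perY disj indep Ia.
pose f x := 2 * I x + Y x.
have perf x : f (x + N) = f x by rewrite /f perI perY.
have f_le2 x : f x <= 2.
  by have := disj x; rewrite /f; case: (I x); case: (Y x) => // /(_ isT).
(* Modulo N, the point x + (N - K) is x - K, so the two are adjacent. *)
have f_opp x : f x + f (x + (N - K)) <= 2.
  have [Ix|nIx] := boolP (I x).
    have /andP[/negbTE nI /negbTE nY] : ~~ I (x + (N - K)) && ~~ Y (x + (N - K)).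
      by apply: indep => //; lia.
    by rewrite {2}/f nI nY addn0 f_le2.
  have [Ix|nIx'] := boolP (I (x + (N - K))).
    have /andP[/negbTE nI /negbTE nY] : ~~ I x && ~~ Y x.
      have := indep _ K Ix; rewrite -addnA subnK; last by lia.
      by rewrite perI perY; apply; lia.
    by rewrite {1}/f nI nY f_le2.
  by rewrite /f (negbTE nIx) (negbTE nIx') /=; case: (Y _); case: (Y _).
have f_far d : K <= d < N - K + 1 -> f (a + d) = 0.
  move=> dK; have /andP[/negbTE nI /negbTE nY] : ~~ I (a + d) && ~~ Y (a + d).
    by apply: indep => //; lia.
  by rewrite /f nI nY.
have -> : 2 * (\sum_(0 <= x < N) I x) + \sum_(0 <= x < N) Y x =
          \sum_(0 <= d < N) f (a + d).
  rewrite big_distrr /= -big_split /= -(sum_periodic a perf) -{1}[a]add0n [a + N]addnC.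
  by rewrite big_addn addnK; apply: eq_bigr => d _; rewrite addnC.
rewrite (big_cat_nat (n := 1)) //=; last by lia.
rewrite (big_cat_nat (m := 1) (n := K)) //=; last by lia.
rewrite (big_cat_nat (m := K) (n := N - K + 1)) /=; [|by lia|by lia].
rewrite big_nat1 addn0 [X in _ + (_ + (X + _))]big_nat.
rewrite [X in _ + (_ + (X + _))]big1 // add0n.
have -> : N - K + 1 = 1 + (N - K) by lia.
rewrite big_addn subKn -?big_split /=; last by lia.
have := f_le2 a.
have : \sum_(1 <= i < K) (f (a + i) + f (a + (i + (N - K)))) <= \sum_(1 <= i < K) 2.
  by apply: leq_sum => i _; rewrite addnA f_opp.
by rewrite sum_nat_const_nat; lia.
Qed.

(** * Colour-matching permutations *)

(** Two colourings of a finite type with the same colour counts list the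
    same colours up to order, and a permutation of the list is a permutation
    of the type. *)
Lemma perm_of_color_counts (T : finType) (C : eqType) (c d : T -> C) :
    (forall x, #|[pred t | c t == x]| = #|[pred t | d t == x]|) ->
  exists g : {perm T}, forall t, d (g t) = c t.
Proof.
move=> cd.
have /tuple_permP[s ds] : perm_eq (codom c) (codom_tuple d).
  apply/allP=> x _ /=; apply/eqP; rewrite /codom !count_map -!size_filter.
  by have := cd x; rewrite !cardE /enum_mem !unlock /=.
have inj : injective (fun t => enum_val (s (enum_rank t))).
  by move=> t u /enum_val_inj/perm_inj/enum_rank_inj.
exists (perm inj) => t; rewrite permE.
have := congr1 (fun r => nth (c t) r (enum_rank t)) ds.
rewrite /codom (nth_map t) -?cardE ?nth_enum_rank // => ->.
by rewrite -tnth_nth tnth_mktuple (tnth_nth (c t)) /= (nth_map t) -?cardE //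
  -enum_val_nth.
Qed.

(** * Multi-part sets *)

Section Parts.

Context {p : nat} (n : 'I_p -> nat).
Implicit Types (A B U : {set ground n}) (k : 'I_p -> nat) (S : {set 'I_p}).

Lemma in_part A i x : (x \in part A i) = (Tagged (fun j => 'I_(n j)) x \in A).
Proof. by rewrite inE. Qed.

Lemma part_tagged A (u : ground n) : (tagged u \in part A (tag u)) = (u \in A).
Proof. by rewrite in_part; case: u. Qed.

Lemma part_inj A B : (forall i, part A i = part B i) -> A = B.
Proof. by move=> AB; apply/setP=> u; rewrite -!part_tagged AB. Qed.

Definition of_parts (f : forall i, {set 'I_(n i)}) : {set ground n} :=
  [set u | tagged u \in f (tag u)].

Lemma part_of_parts f i : part (of_parts f) i = f i.
Proof. by apply/setP=> x; rewrite in_part inE. Qed.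

Lemma part_image A i :
  [set u in A | tag u == i] = Tagged (fun j => 'I_(n j)) @: part A i.
Proof.
apply/setP=> u; apply/idP/imsetP => [|[x]].
  rewrite inE => /andP[uA /eqP tu]; case: u uA tu => j x /= xA ij; subst j.
  by exists x; rewrite ?inE.
by rewrite in_part => xA ->; rewrite inE xA /= eqxx.
Qed.

Lemma card_part A i : #|part A i| = #|[set u in A | tag u == i]|.
Proof.
rewrite part_image card_imset // => x y /eqP.
by rewrite eq_Tagged => /eqP.
Qed.

Lemma partU A B i : part (A :|: B) i = part A i :|: part B i.
Proof. by apply/setP=> x; rewrite !inE. Qed.

Lemma partI A B i : part (A :&: B) i = part A i :&: part B i.
Proof. by apply/setP=> x; rewrite !inE. Qed.

Lemma part0 i : part (set0 : {set ground n}) i = set0.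
Proof. by apply/setP=> x; rewrite !inE. Qed.

Lemma partI0 A B i : A :&: B = set0 -> part A i :&: part B i = set0.
Proof. by move=> AB; rewrite -partI AB part0. Qed.

Lemma layersP k S A :
  reflect (forall i, #|part A i| = if i \in S then k i else 0)
          (A \in layers n k S).
Proof.
rewrite inE; apply: (iffP forallP) => AS i; first exact/eqP.
by rewrite AS.
Qed.

Lemma exists_disjoint k S U :
    (forall i, i \in S -> k i + #|part U i| <= n i) ->
  exists2 B, B \in layers n k S & U :&: B = set0.
Proof.
move=> kU; pose f i := [set x in take (k i) (enum (~: part U i))].
have fU i x : x \in f i -> x \notin part U i.
  by rewrite inE => /mem_take; rewrite mem_enum inE.
(* Avoid U by taking the first k i points outside U in each part of S. *)
exists (of_parts (fun i => if i \in S then f i else set0)).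
  apply/layersP=> i; rewrite part_of_parts; case: ifP => iS; last exact: cards0.
  rewrite cardsE; move/card_uniqP: (take_uniq (k i) (enum_uniq (~: part U i))) => ->.
  rewrite size_take -cardE.
  have := kU i iS; have := cardsC (part U i); rewrite card_ord; case: ltnP; lia.
apply/setP=> u; rewrite !inE; apply/negP=> /andP[uU].
by case: ifP => [_ /fU|_]; [rewrite part_tagged uU | rewrite inE].
Qed.

End Parts.

(** * Symmetries of the ground set *)

Section Symmetries.

Context {p : nat} (n : 'I_p -> nat).
Implicit Types (A B U : {set ground n}) (k : 'I_p -> nat) (S : {set 'I_p}).
Implicit Types g h : {perm ground n}.

Definition part_perms : {set {perm ground n}} :=
  [set g : {perm ground n} | [forall u, tag (g u) == tag u]].

Lemma part_permsP g :
  reflect (forall u, tag (g u) = tag u) (g \in part_perms).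
Proof. by rewrite inE; apply: (iffP forallP) => gt u; apply/eqP. Qed.

Lemma part_permsM g h :
  g \in part_perms -> h \in part_perms -> (g * h)%g \in part_perms.
Proof.
move=> /part_permsP gt /part_permsP ht; apply/part_permsP=> u.
by rewrite permM ht gt.
Qed.

Lemma part_permsV g : g \in part_perms -> (g^-1)%g \in part_perms.
Proof.
move=> /part_permsP gt; apply/part_permsP=> u.
by rewrite -(gt ((g^-1)%g u)) permKV.
Qed.

Lemma card_part_perms_gt0 : 0 < #|part_perms|.
Proof.
by apply/card_gt0P; exists 1%g; apply/part_permsP=> u; rewrite perm1.
Qed.

Lemma imset_permM g h A : h @: (g @: A) = (g * h)%g @: A.
Proof. by rewrite -imset_comp; apply: eq_imset => u; rewrite permM. Qed.

Lemma imset_permK g A : (g^-1)%g @: (g @: A) = A.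
Proof.
by by rewrite imset_permM mulgV (eq_imset _ (@perm1 _)) imset_id.
Qed.

Lemma imset_permKV g A : g @: ((g^-1)%g @: A) = A.
Proof. by rewrite -{1}[g]invgK imset_permK. Qed.

Lemma imset_layers g k S A :
  g \in part_perms -> (g @: A \in layers n k S) = (A \in layers n k S).
Proof.
move=> /part_permsP gt.
have eq_card_part i : #|part (g @: A) i| = #|part A i|.
  rewrite !card_part -[RHS](card_imset _ (@perm_inj _ g)); congr #|pred_of_set _|.
  apply/setP=> u; apply/idP/imsetP => [|[v /[!inE]/andP[vA tv] ->]].
    rewrite inE => /andP[/imsetP[v vA ->] /eqP tv].
    by exists v => //; rewrite inE vA -tv gt eqxx.
  by rewrite gt tv andbT mem_imset //; apply: perm_inj.
by rewrite !inE; apply: eq_forallb => i; rewrite eq_card_part.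
Qed.

(** The sizes of the four cells cut out of a part by two disjoint sets
    depend only on the sizes of their traces; this is what makes pairs of
    disjoint members of the layer interchangeable. *)
Lemma color_count A B i a b : A :&: B = set0 ->
  #|[pred u | (tag u, u \in A, u \in B) == (i, a, b)]| =
  if a then if b then 0 else #|part A i|
  else if b then #|part B i| else n i - #|part A i| - #|part B i|.
Proof.
move=> AB0.
have AB x : x \in part A i -> x \in part B i -> False.
  by move=> xA xB; have := in_set0 x; rewrite -(partI0 i AB0) inE xA xB.
have -> : #|[pred u | (tag u, u \in A, u \in B) == (i, a, b)]| =
    #|[set x | ((x \in part A i) == a) && ((x \in part B i) == b)]|.
  rewrite -cardsE.
  pose U := [set u : ground n | ((u \in A) == a) && ((u \in B) == b)].
  transitivity #|part U i|.
    rewrite card_part; apply: eq_card => u.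
    by rewrite !inE !xpair_eqE -andbA andbC.
  by apply: eq_card => x; rewrite !inE.
case: a; case: b.
- by apply/eqP; rewrite cards_eq0; apply/eqP/setP=> x; rewrite !inE;
    apply/negP=> /andP[/eqP xA /eqP xB]; apply: (AB x); rewrite inE.
- apply: eq_card => x; rewrite inE; case: (boolP (x \in part B i)) => xB.
    by rewrite andbF; apply/esym/negP=> xA; apply: AB xA xB.
  by rewrite eqb_id andbT.
- apply: eq_card => x; rewrite inE; case: (boolP (x \in part A i)) => xA.
    by rewrite /=; apply/esym/negP=> xB; apply: AB xA xB.
  by rewrite eqb_id.
have -> : [set x | ((x \in part A i) == false) && ((x \in part B i) == false)] =
    ~: (part A i :|: part B i).
  by apply/setP=> x; rewrite !inE negb_or !eqbF_neg.
rewrite cardsCs setCK cardsU (partI0 i AB0) cards0 subn0 card_ord.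
by rewrite subnDA.
Qed.

(** Colour each point by its part and by its membership in A and in B; a
    permutation that matches this colouring with the one of A', B' carries
    one pair to the other and keeps every point in its part. *)
Lemma disjoint_pairs_transitive k A B A' B' :
    let X := layers n k setT in
    A \in X -> B \in X -> A' \in X -> B' \in X ->
    A :&: B = set0 -> A' :&: B' = set0 ->
  exists2 g, g \in part_perms & g @: A = A' /\ g @: B = B'.
Proof.
move=> X /layersP AX /layersP BX /layersP AX' /layersP BX' AB AB'.
have [g gc] : exists g : {perm ground n}, forall u,
    (tag (g u), g u \in A', g u \in B') = (tag u, u \in A, u \in B).
  apply: (perm_of_color_counts (c := fun u => (tag u, u \in A, u \in B))
                               (d := fun u => (tag u, u \in A', u \in B'))).
  by move=> [[i a] b]; rewrite !color_count // AX BX AX' BX'.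
have gt u : tag (g u) = tag u by case: (gc u).
have gA u : (g u \in A') = (u \in A) by case: (gc u).
have gB u : (g u \in B') = (u \in B) by case: (gc u).
exists g; first exact/part_permsP.
have gim (C C' : {set ground n}) : (forall u, (g u \in C') = (u \in C)) -> g @: C = C'.
  move=> gC; apply/setP=> u; rewrite -[u](permKV g) gC mem_imset //.
  exact: perm_inj.
by split; apply: gim.
Qed.

End Symmetries.

(** * Embedding a cycle of arcs into the layer *)

Lemma card_arc m c s : 0 < m -> c <= m ->
  #|[set y : 'I_m | [exists t : 'I_c, val y == (s + t) %% m]]| = c.
Proof.
move=> m0 cm; pose f (t : 'I_c) : 'I_m := Ordinal (ltn_pmod (s + t) m0).
have finj : injective f.
  move=> t u /(congr1 val)/eqP /=; rewrite eqn_modDl !modn_small; first exact: val_eqP.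
  - exact: leq_trans (ltn_ord _) cm.
  - exact: leq_trans (ltn_ord _) cm.
rewrite -[RHS](card_ord c) -cardsT -(card_imset _ finj); apply: eq_card => y.
rewrite inE; apply/existsP/imsetP => [[t /eqP yt]|[t _ ->]]; last by exists t.
by exists t => //; apply: val_inj.
Qed.

Section Cycle.

Context {p : nat} (n k : 'I_p -> nat).
Hypotheses (k_gt0 : forall i, 0 < k i) (le2kn : forall i, 2 * k i <= n i).
Implicit Types (A B : {set ground n}) (Y I W : {set {set ground n}}).
Implicit Types g h : {perm ground n}.
Local Notation layer := (layers n k setT).

Lemma card_part_layer A i : A \in layer -> #|part A i| = k i.
Proof. by move/layersP/(_ i); rewrite inE. Qed.

Lemma layer_disjoint_partner A : A \in layer -> exists2 B, B \in layer & A :&: B = set0.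
Proof.
move=> AX; apply: exists_disjoint => i _; rewrite card_part_layer //.
by have := le2kn i; lia.
Qed.

Lemma layer_nonempty : exists A, A \in layer.
Proof.
have [i _|A AX _] := exists_disjoint (k := k) (S := setT) (U := set0 : {set ground n}).
  by rewrite part0 cards0; have := le2kn i; lia.
by exists A.
Qed.

Lemma layer_transitive A B : A \in layer -> B \in layer ->
  exists2 g, g \in part_perms n & g @: A = B.
Proof.
move=> AX BX; have [A' AX' AA'] := layer_disjoint_partner AX.
have [B' BX' BB'] := layer_disjoint_partner BX.
by have [g gP [gA _]] := disjoint_pairs_transitive AX AX' BX BX' AA' BB'; exists g.
Qed.

(** By transitivity, the number of symmetries that send A into W is the same
    for all A of the layer; summing it over A counts each symmetry #|W|
    times. *)
Lemma card_perms_into A W : A \in layer -> W \subset layer ->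
  #|layer| * #|[set g in part_perms n | g @: A \in W]| = #|part_perms n| * #|W|.
Proof.
move=> AX WX.
have same B : B \in layer -> #|[set g in part_perms n | g @: B \in W]| =
                         #|[set g in part_perms n | g @: A \in W]|.
  move=> BX; have [h hP hA] := layer_transitive AX BX.
  rewrite -[RHS](card_imset _ (mulgI (h^-1)%g)); apply: eq_card => g.
  apply/idP/imsetP => [/setIdP[gP gW]|[f /setIdP[fP fW] ->]].
    exists (h * g)%g; last by rewrite mulKg.
    by rewrite in_set part_permsM //= -imset_permM hA.
  by rewrite in_set -hA imset_permM mulKVg fW part_permsM ?part_permsV.
have images g : g \in part_perms n -> \sum_(B in layer) (g @: B \in W) = #|W|.
  move=> gP; rewrite -big_mkcondr /= sum1_card.
  rewrite -[RHS](card_imset _ (imset_inj (@perm_inj _ (g^-1)%g))).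
  apply: eq_card => B; rewrite -topredE /=; apply/andP/imsetP => [[_ gBW]|[C CW ->]].
    by exists (g @: B); rewrite ?imset_permK.
  rewrite imset_permKV CW -(imset_layers _ _ _ gP); split=> //.
  by rewrite imset_permKV (subsetP WX).
rewrite -sum_nat_const -(eq_bigr _ same).
under eq_bigr => B _ do rewrite -sum1_card.
rewrite -sum_nat_const -(eq_bigr _ images) exchange_big /=.
apply: eq_bigr => B _; rewrite -big_mkcondr /=.
by apply: eq_bigl => g; rewrite in_set.
Qed.

Variable i0 : 'I_p.
Hypothesis min_i0 : forall i, n i0 * k i <= n i * k i0.
Local Notation N := (n i0).
Local Notation K := (k i0).

Let N_gt0 : 0 < N.
Proof. by have := le2kn i0; have := k_gt0 i0; lia. Qed.

(** Going once around the cycle, in N steps, turns the arc once around every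
    part. The positions x * n i / N are scaled from part i0, where the start
    is x itself; arcs that are disjoint there stay disjoint in the other
    parts, whose ratio n i / k i is at least as large. *)
Definition arcs x : {set ground n} :=
  of_parts (fun i => [set y : 'I_(n i) |
    [exists t : 'I_(k i), val y == (x * n i %/ N + t) %% n i]]).

Lemma arcs_layer x : arcs x \in layer.
Proof.
apply/layersP=> i; rewrite part_of_parts inE card_arc //.
- by have := le2kn i; have := k_gt0 i; lia.
- by have := le2kn i; lia.
Qed.

Lemma arcs_periodic x : arcs (x + N) = arcs x.
Proof.
apply: part_inj => i; rewrite !part_of_parts; apply/setP=> y; rewrite !inE.
apply: eq_existsb => t; congr (_ == _).
by rewrite mulnDl [N * _]mulnC [x * _ + _]addnC divnMDl // -addnA modnDl.
Qed.

(** Moving d steps with K <= d <= N - K moves the arc in part i by at least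
    d * n i / N >= k i and at most n i - k i, since N * k i <= n i * K;
    rounding down preserves bounds by integers. *)
Lemma arcs_disjoint x d : K <= d <= N - K -> arcs x :&: arcs (x + d) = set0.
Proof.
move=> /andP[Kd dN]; apply/setP=> u; rewrite !inE; apply/negP.
move: (tag u) (tagged u) => i y {u}.
case/andP=> /existsP[t /eqP yt] /existsP[t' /eqP]; rewrite yt => /eqP.
have := min_i0 i; have := le2kn i; have := k_gt0 i; have := le2kn i0.
set s := x * n i %/ N; set s' := (x + d) * n i %/ N => KN ki0 kn min.
have lo : s + k i <= s'.
  rewrite addnC -divnMDl // leq_div2r // mulnDl addnC leq_add2l mulnC.
  by rewrite (leq_trans min) // mulnC leq_mul2r Kd orbT.
have hi : s' <= s + (n i - k i).
  rewrite addnC -divnMDl // leq_div2r // mulnDl [leqRHS]addnC leq_add2l.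
  rewrite (leq_trans (leq_mul dN (leqnn _))) // !mulnBl [n i * N]mulnC.
  by rewrite leq_sub2l // [k i * N]mulnC [K * _]mulnC.
have -> : s' + t' = s + (s' - s + t') by lia.
by rewrite eqn_modDl !modn_small; have := ltn_ord t; have := ltn_ord t'; lia.
Qed.

Definition arc_count g W := \sum_(0 <= x < N) (g @: arcs x \in W).

Lemma arc_count_shift g W d :
  \sum_(0 <= x < N) (g @: arcs (x + d) \in W) = arc_count g W.
Proof.
transitivity (\sum_(d <= x < d + N) (g @: arcs x \in W)).
  by rewrite -{2}[d]add0n [d + N]addnC big_addn addnK.
apply: (sum_periodic (f := fun x => nat_of_bool (g @: arcs x \in W))) => x.
by rewrite arcs_periodic.
Qed.

Lemma sum_arc_count W : W \subset layer ->
  #|layer| * \sum_(g in part_perms n) arc_count g W = N * (#|part_perms n| * #|W|).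
Proof.
move=> WX; rewrite exchange_big big_distrr /=.
rewrite -[X in X * (_ * _)]subn0 -sum_nat_const_nat; apply: eq_bigr => x _.
rewrite -(card_perms_into (arcs_layer x) WX); congr (_ * _).
rewrite -big_mkcondr /= sum1_card.
by apply: eq_card => g; rewrite in_set.
Qed.

(** Over all symmetric copies of the cycle of arcs, every member of the
    layer is hit equally often. A linear inequality between densities thus
    follows from its version on each copy, and it is an equality only if all
    copies attain it. *)
Lemma averaging Y I a b c : Y \subset layer -> I \subset layer ->
    (forall g, g \in part_perms n -> a * arc_count g Y + b * arc_count g I <= c * N) ->
  a * #|Y| + b * #|I| <= c * #|layer| ?= iff
  [forall g in part_perms n, a * arc_count g Y + b * arc_count g I == c * N].
Proof.
move=> YX IX le_g.
have := leqif_sum (P := mem (part_perms n)) (fun g gP => leqif_eq (le_g g gP)).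
rewrite sum_nat_const big_split /= -!big_distrr /=.
set sY := \sum_(_ in _) _; set sI := \sum_(_ in _) _.
have eqY : #|layer| * sY = _ := sum_arc_count YX.
have eqI : #|layer| * sI = _ := sum_arc_count IX.
have X0 : 0 < #|layer| by have [A AX] := layer_nonempty; apply/card_gt0P; exists A.
have G0 := card_part_perms_gt0 n.
have NG0 : 0 < N * #|part_perms n| by rewrite muln_gt0 N_gt0.
have eL : #|layer| * (a * sY + b * sI) = N * #|part_perms n| * (a * #|Y| + b * #|I|).
  rewrite mulnDr mulnCA eqY [_ * (b * _)]mulnCA eqI; lia.
have eR : #|layer| * (#|part_perms n| * (c * N)) = N * #|part_perms n| * (c * #|layer|).
  by lia.
case=> le_s eq_s; split.
  by rewrite -(leq_pmul2l NG0) -eL -eR leq_pmul2l.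
by rewrite -(eqn_pmul2l NG0) -eL -eR eqn_pmul2l.
Qed.

(** * Inequalities read off the cycle *)

Definition meets (F G : {set {set ground n}}) : Prop :=
  forall A B, A \in F -> B \in G -> A :&: B != set0.

Lemma arcs_imset_disjoint g x d : K <= d <= N - K ->
  (g @: arcs x) :&: (g @: arcs (x + d)) = set0.
Proof.
move=> dK; rewrite -imsetI ?arcs_disjoint ?imset0 // => u v _ _.
exact: perm_inj.
Qed.

Lemma arc_count_bound g Y I : meets I (I :|: Y) -> [disjoint I & Y] ->
  0 < arc_count g I -> 2 * arc_count g I + arc_count g Y <= 2 * K.
Proof.
move=> meetI IY cI.
have [a Ia] : exists a, g @: arcs a \in I.
  have [x Ix|I0] := pickP (fun x : 'I_N => g @: arcs x \in I); first by exists x.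
  by move: cI; rewrite /arc_count big_mkord big1 // => x _; rewrite I0.
apply: (@cycle_bound (fun x => g @: arcs x \in I) (fun x => g @: arcs x \in Y)
          N K a) => //.
- by move=> x; rewrite arcs_periodic.
- by move=> x; rewrite arcs_periodic.
- by move=> x xI; rewrite (disjointFr IY xI).
move=> x d xI dK; have x0 := arcs_imset_disjoint g x dK.
rewrite -negb_or; apply/negP=> xd.
by have := meetI _ (g @: arcs (x + d)) xI; rewrite inE xd x0 eqxx => /(_ isT).
Qed.

Lemma arc_countC g W : arc_count g W + arc_count g (~: W) = N.
Proof.
rewrite -big_split /= -[RHS]subn0 -[RHS]muln1 -sum_nat_const_nat.
by apply: eq_bigr => x _; rewrite inE; case: (_ \in W).
Qed.

Lemma arc_count_gt0 g W x : x < N -> g @: arcs x \in W -> 0 < arc_count g W.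
Proof. by move=> xN xW; rewrite /arc_count big_mkord (bigD1 (Ordinal xN)) //= xW. Qed.

Lemma arc_count_full g W x :
  arc_count g W = N -> x < N -> g @: arcs x \in W.
Proof.
move=> full xN; apply/negPn/negP=> xW.
have := @arc_count_gt0 g (~: W) x xN; rewrite inE => /(_ xW).
by have := arc_countC g W; lia.
Qed.

(** If I misses this copy of the cycle, the bound is arc_count g Y <= N.
    Otherwise 2 cI + cY <= 2 K, and the bound follows by convexity from the
    extreme case cI = K, because 2 K <= N. *)
Lemma arc_weight_le g Y I : meets I (I :|: Y) -> [disjoint I & Y] ->
  K * arc_count g Y + N * arc_count g I <= K * N.
Proof.
move=> mI IY; have := arc_count_bound (g := g) mI IY.
have cY := arc_countC g Y; have KN := le2kn i0.
case: posnP => [->|_] cI.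
  by rewrite muln0 addn0 leq_mul2l; apply/orP; right; lia.
have le1 := leq_mul (leqnn K) (cI isT).
have le2 : (N - 2 * K) * arc_count g I <= (N - 2 * K) * K.
  by rewrite leq_mul2l; apply/orP; right; lia.
by rewrite !mulnBl in le2; nia.
Qed.

Lemma weighted_bound Y I : Y \subset layer -> I \subset layer ->
    meets I (I :|: Y) -> [disjoint I & Y] ->
  K * #|Y| + N * #|I| <= K * #|layer|.
Proof.
move=> YX IX mI IY; have [] // := averaging (a := K) (b := N) (c := K) YX IX.
by move=> g _; apply: arc_weight_le.
Qed.

(** When 2 K < N, a tight copy of the cycle lies entirely in Y or misses Y.
    Any disjoint A, B occur as positions 0 and K of some copy, so Y passes
    from A to B. *)
Lemma weighted_eq_closed Y I A B : Y \subset layer -> I \subset layer ->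
    meets I (I :|: Y) -> [disjoint I & Y] -> 2 * K < N ->
    K * #|Y| + N * #|I| = K * #|layer| ->
    A \in Y -> B \in layer -> A :&: B = set0 -> B \in Y.
Proof.
move=> YX IX mI IY KN eqYI AY BX AB.
have [|_ /esym] := averaging (a := K) (b := N) (c := K) YX IX.
  by move=> g _; apply: arc_weight_le.
rewrite eqYI eqxx => /forall_inP eq_g.
have K1 : 0 < K by [].
have [|g gP [gA gB]] := disjoint_pairs_transitive (arcs_layer 0) (arcs_layer (0 + K))
    (subsetP YX _ AY) BX _ AB.
  by apply: arcs_disjoint; lia.
have cY : 0 < arc_count g Y by apply: (@arc_count_gt0 g Y 0); rewrite ?gA.
have := arc_count_bound (g := g) mI IY; have := eqP (eq_g g gP).
case: posnP => [->|cI] /= eqg.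
  move=> _; rewrite -gB; apply: arc_count_full; last by lia.
  by apply/eqP; rewrite -(eqn_pmul2l K1) -eqg muln0 addn0.
by move=> /(_ isT) cle; nia.
Qed.

(** For N = 2 K the positions x and x + K are antipodal: at most one of the
    events that the first lies in Y and the second in I occurs. Tightness
    forces exactly one, for every disjoint pair of the layer. *)
Lemma cross_pair_bound Y I : Y \subset layer -> I \subset layer -> meets Y I ->
    N = 2 * K ->
  #|Y| + #|I| <= #|layer| ?= iff
  [forall A in layer, forall B in layer,
     (A :&: B == set0) ==> ((A \in Y) == (B \notin I))].
Proof.
move=> YX IX mYI NK.
pose E g x := (g @: arcs x \in Y) + (g @: arcs (x + K) \in I).
have E_le1 g x : E g x <= 1.
  rewrite /E; case xY: (_ \in Y) => //; case xI: (_ \in I) => //.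
  by have := mYI _ _ xY xI; rewrite arcs_imset_disjoint ?eqxx //; lia.
have sumE g : arc_count g Y + arc_count g I <= N ?= iff [forall x : 'I_N, E g x == 1].
  rewrite -(arc_count_shift g I K) -big_split /= big_mkord.
  have := leqif_sum (P := predT) (fun (x : 'I_N) _ => leqif_eq (E_le1 g x)).
  by rewrite sum1_card card_ord.
have le_g g : g \in part_perms n -> 1 * arc_count g Y + 1 * arc_count g I <= 1 * N.
  by move=> _; rewrite !mul1n; apply: sumE.
have := averaging YX IX le_g; rewrite !mul1n => [[le_sum eq_sum]]; split=> //.
rewrite eq_sum; apply/forall_inP/forall_inP => [eq_g A AX|eqAB g gP].
  apply/forall_inP=> B BX; apply/implyP=> /eqP AB.
  have [|g gP [gA gB]] := disjoint_pairs_transitive (arcs_layer 0) (arcs_layer (0 + K))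
    AX BX _ AB; first by apply: arcs_disjoint; lia.
  have := eq_g g gP; rewrite !mul1n sumE => /forallP/(_ (Ordinal N_gt0)).
  by rewrite /E /= gA gB; case: (A \in Y); case: (B \in I).
rewrite !mul1n sumE; apply/forallP=> x; rewrite /E.
have AX : g @: arcs x \in layer by rewrite imset_layers ?arcs_layer.
have BX : g @: arcs (x + K) \in layer by rewrite imset_layers ?arcs_layer.
have := forall_inP (eqAB _ AX) _ BX; rewrite arcs_imset_disjoint ?eqxx /=; last by lia.
by move/eqP=> ->; case: (_ \in I).
Qed.

(** The sets that contain a fixed point of part i0. By symmetry all N stars
    of that part have the same size, and each set of the layer lies in K of
    them. *)
Lemma star_family : exists I,
  [/\ I \subset layer, intersecting I & N * #|I| = K * #|layer|].
Proof.
pose pt (x : 'I_N) : ground n := Tagged (fun j => 'I_(n j)) x.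
pose star x := [set A in layer | pt x \in A].
pose x0 := Ordinal N_gt0; exists (star x0).
have same x : #|star x| = #|star x0|.
  have tP : tperm (pt x) (pt x0) \in part_perms n.
    by apply/part_permsP=> u; case: tpermP => // ->.
  rewrite -(card_imset _ (imset_inj (@perm_inj _ (tperm (pt x) (pt x0))))).
  have inP A y : (tperm (pt x) (pt x0) y \in tperm (pt x) (pt x0) @: A) = (y \in A).
    by rewrite mem_imset //; apply: perm_inj.
  apply: eq_card => A; apply/imsetP/setIdP => [[B /setIdP[BX xB] ->]|[AX xA]].
    by rewrite imset_layers // -[X in X \in _ @: _](tpermL (pt x)) inP.
  exists (tperm (pt x) (pt x0) @: A); last first.
    by rewrite -{1}[tperm _ _]tpermV imset_permK.
  by rewrite in_set imset_layers // AX -[X in X \in _ @: _](tpermR (pt x) (pt x0)) inP.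
split; first by apply/subsetP=> A /setIdP[].
  move=> A B /setIdP[_ xA] /setIdP[_ xB]; apply/set0Pn; exists (pt x0).
  by rewrite inE xA.
have -> : N * #|star x0| = \sum_(x : 'I_N) #|star x|.
  by rewrite (eq_bigr _ (fun x _ => same x)) sum_nat_const card_ord.
under eq_bigr => x _ do rewrite -sum1_card.
under eq_bigr => x _ do under eq_bigl => A do rewrite in_set.
rewrite (exchange_big_dep (mem layer)) /=; last by move=> x A _ /andP[].
rewrite mulnC -sum_nat_const; apply: eq_bigr => A AX.
rewrite -(card_part_layer i0 AX) -sum1_card; apply: eq_bigl => x.
by rewrite AX in_part.
Qed.

(** Connectivity. If n i > 2 k i, exchanging one point of A in part i for
    another leaves room for a set disjoint from both the old set and the new
    one, so the exchange is a two-step move; a sequence of exchanges turns A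
    into A'. Where n i = 2 k i, the trace of A is restored by any two steps,
    and exchanges there are impossible. *)
Lemma two_step_closed W A A' : W \subset layer ->
    (forall B C D, B \in W -> C \in layer -> D \in layer ->
       B :&: C = set0 -> C :&: D = set0 -> D \in W) ->
    A \in W -> A' \in layer ->
    (forall i, n i = 2 * k i -> part A i = part A' i) ->
  A' \in W.
Proof.
move=> WX step; have [m] := ubnP #|A :\: A'|; elim: m A => // m IHm A Am AW AX' eqA.
have AX := subsetP WX _ AW.
have [A0|[u]] := set_0Vmem (A :\: A').
  suff -> : A' = A by [].
  apply: part_inj => i; apply/esym/eqP; rewrite eqEcard !card_part_layer // leqnn andbT.
  apply/subsetP=> x; rewrite !in_part => xA; apply/negPn/negP=> xA'.
  by have := in_set0 (Tagged (fun j => 'I_(n j)) x); rewrite -A0 inE xA xA'.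
rewrite inE => /andP[uA' uA].
have [v vA' [vA tv]] : exists2 v, v \in A' & v \notin A /\ tag v = tag u.
  have /subsetPn[y yA' yA] : ~~ (part A' (tag u) \subset part A (tag u)).
    apply/negP=> sub; have /eqP eqp : part A' (tag u) == part A (tag u).
      by rewrite eqEcard sub !card_part_layer /=.
    by move: uA'; rewrite -part_tagged eqp part_tagged uA.
  by exists (Tagged (fun j => 'I_(n j)) y); rewrite -?in_part.
have ni : 2 * k (tag u) < n (tag u).
  rewrite ltn_neqAle le2kn andbT; apply/eqP=> /esym/eqA eqp.
  by move: uA'; rewrite -part_tagged -eqp part_tagged uA.
(* The exchange: u leaves A, and v of the same part enters. *)
pose A1 := v |: (A :\ u).
have card_part1 j : #|part A1 j| = k j.
  rewrite -(card_part_layer j AX) !card_part.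
  have [->|ju] := eqVneq j (tag u).
    have -> : [set w in A1 | tag w == tag u] = v |: ([set w in A | tag w == tag u] :\ u).
      by apply/setP=> w; rewrite !inE; case: eqVneq => [->|_]; rewrite /= ?tv ?eqxx -?andbA.
    rewrite cardsU1 !inE (negbTE vA) andbF add1n.
    by rewrite [RHS](cardsD1 u) inE uA eqxx.
  have uj : (tag u == j) = false by rewrite eq_sym; apply/negbTE.
  apply: eq_card => w; rewrite !inE; case: eqVneq => [->|_] /=.
    by rewrite (negbTE vA) tv uj.
  by case: eqVneq => [->|_] //=; rewrite uj andbF.
have A1X : A1 \in layer by apply/layersP=> j; rewrite inE card_part1.
(* B avoids both A and A1, whose union is v |: A. *)
have [j _|B BX BU] := exists_disjoint (k := k) (S := setT) (U := v |: A).
  have -> : #|part (v |: A) j| = (j == tag u) + k j.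
    rewrite card_part -(card_part_layer j AX) card_part.
    have [->|ju] := eqVneq j (tag u).
      have -> : [set w in v |: A | tag w == tag u] = v |: [set w in A | tag w == tag u].
        by apply/setP=> w; rewrite !inE; case: eqVneq => [->|_]; rewrite /= ?tv ?eqxx.
      by rewrite cardsU1 !inE (negbTE vA).
    have uj : (tag u == j) = false by rewrite eq_sym; apply/negbTE.
    by apply: eq_card => w; rewrite !inE; case: eqVneq => [->|_]; rewrite /= ?tv ?uj ?andbF.
  rewrite addnCA addnn -mul2n; case: eqVneq => [->|_]; first by rewrite add1n ni.
  by rewrite add0n le2kn.
apply: (IHm A1) => //.
- suff : A1 :\: A' \proper A :\: A' by move/proper_card/leq_trans; apply.
  apply/properP; split; last first.
    exists u; rewrite !inE ?uA ?uA' // eqxx /= orbF.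
    by apply: contra vA => /eqP <-.
  apply/subsetP=> w; rewrite !inE => /andP[wA' /orP[/eqP wv|/andP[_ ->]]]; last by rewrite wA'.
  by rewrite wv vA' in wA'.
- apply: (step A B) => //; apply/eqP; rewrite -subset0 -BU.
    by rewrite setSI // subsetUr.
  by rewrite setIC setSI // setUS // subD1set.
move=> i ik; rewrite -eqA //; apply/setP=> x; rewrite !in_part !inE.
have tx w : tag w = tag u -> (Tagged (fun j => 'I_(n j)) x == w) = false.
  by move=> tw; apply/negP=> /eqP xw; move: ni; rewrite -tw -xw /= ik ltnn.
by rewrite !tx.
Qed.

End Cycle.

(** * Cardinalities and products of layers *)

Section Products.

Context {p : nat} (n k : 'I_p -> nat).
Implicit Types (A B D : {set ground n}) (S : {set 'I_p}) (C R : {set {set ground n}}).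

Lemma card_layers S : #|layers n k S| = \prod_(i in S) 'C(n i, k i).
Proof.
pose F i := [pred B : {set 'I_(n i)} | #|B| == if i \in S then k i else 0].
pose to_parts (A : {set ground n}) : {dffun forall i : 'I_p, {set 'I_(n i)}} :=
  [ffun i => part A i].
have inj : injective to_parts.
  by move=> A B /ffunP eqAB; apply: part_inj => i; have := eqAB i; rewrite !ffunE.
transitivity #|(family F : simpl_pred {dffun forall i : 'I_p, {set 'I_(n i)}})|.
  rewrite -(card_imset _ inj); apply: eq_card => f.
  apply/imsetP/familyP => [[A /layersP AS -> i]|fF].
    by rewrite ffunE inE AS.
  exists (of_parts f); last by apply/ffunP=> i; rewrite ffunE part_of_parts.
  by apply/layersP=> i; rewrite part_of_parts; apply/eqP; have := fF i; rewrite inE.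
rewrite card_family foldrE big_map big_enum /= [RHS]big_mkcond /=.
apply: eq_bigr => i _; rewrite -[n i in RHS]card_ord; case: ifP => iS.
  by rewrite -card_draws -cardsE; apply: eq_card => B; rewrite !inE.
rewrite -[RHS](bin0 #|'I_(n i)|) -card_draws -cardsE.
by apply: eq_card => B; rewrite !inE.
Qed.

Lemma layers_part0 S A i : A \in layers n k S -> i \notin S -> part A i = set0.
Proof. by move=> /layersP/(_ i) cA iS; apply: cards0_eq; rewrite cA (negbTE iS). Qed.

Lemma layers_tag S A u : A \in layers n k S -> u \in A -> tag u \in S.
Proof.
move=> AS uA; apply/negPn/negP=> /(layers_part0 AS) A0.
by move: uA; rewrite -part_tagged A0 inE.
Qed.

Definition restrict S A : {set ground n} := [set u in A | tag u \in S].

Lemma restrict_layers S A : A \in layers n k setT -> restrict S A \in layers n k S.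
Proof.
move/layersP=> AX; apply/layersP=> i; have := AX i; rewrite inE => <-.
case: ifP => iS; first by apply: eq_card => x; rewrite !inE /= iS andbT.
by apply/eqP; rewrite cards_eq0; apply/eqP/setP=> x; rewrite !inE /= iS andbF.
Qed.

Lemma restrictUC S A : restrict S A :|: restrict (~: S) A = A.
Proof. by apply/setP=> u; rewrite !inE -andb_orr orbN andbT. Qed.

Lemma restrictU S D B : D \in layers n k S -> B \in layers n k (~: S) ->
  restrict S (D :|: B) = D.
Proof.
move=> DS BS; apply/setP=> u; rewrite !inE.
have [uD|uD] /= := boolP (u \in D); first by rewrite (layers_tag DS uD).
by apply/negP=> /andP[/(layers_tag BS)]; rewrite inE => /negP.
Qed.

Lemma layersU S D B : D \in layers n k S -> B \in layers n k (~: S) ->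
  D :|: B \in layers n k setT.
Proof.
move=> DS BS; apply/layersP=> i; rewrite inE partU.
have [iS|iS] := boolP (i \in S).
  rewrite (layers_part0 BS) ?inE ?iS // setU0.
  by move/layersP: DS => ->; rewrite iS.
rewrite (layers_part0 DS) // set0U.
by move/layersP: BS => ->; rewrite inE iS.
Qed.

Lemma fam_prod_layers S :
  fam_prod (layers n k S) (layers n k (~: S)) = layers n k setT.
Proof.
apply/setP=> A; apply/imset2P/idP => [[D B DS BS ->]|AX]; first exact: layersU BS.
by exists (restrict S A) (restrict (~: S) A); rewrite ?restrict_layers ?restrictUC.
Qed.

Lemma mem_fam_prod S C D B : C \subset layers n k S ->
    D \in layers n k S -> B \in layers n k (~: S) ->
  (D :|: B \in fam_prod C (layers n k (~: S))) = (D \in C).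
Proof.
move=> CS DS BS; apply/imset2P/idP => [[D' B' D'C B'S eqDB]|DC]; last by exists D B.
by rewrite -(restrictU DS BS) eqDB (restrictU (subsetP CS _ D'C) B'S).
Qed.

Lemma card_fam_prod S C : C \subset layers n k S ->
  #|fam_prod C (layers n k (~: S))| = #|C| * #|layers n k (~: S)|.
Proof.
move=> CS; rewrite /fam_prod curry_imset2X card_in_imset ?cardsX //.
move=> [D B] [D' B'] /setXP[/= DC BS] /setXP[/= DC' BS'] eqDB.
have DS := subsetP CS _ DC; have DS' := subsetP CS _ DC'.
congr (_, _); first by rewrite -(restrictU DS BS) eqDB restrictU.
have {}BS : B \in layers n k (~: S) := BS.
have swap E : E \in layers n k S -> E \in layers n k (~: ~: S) by rewrite setCK.
by rewrite -(restrictU BS (swap _ DS)) setUC eqDB setUC restrictU // swap.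
Qed.

(** The i-th term t i of the maximum satisfies n i * t i = k i * L with L
    the size of the layer, so the largest term is the one with the smallest ratio n i / k i. *)
Lemma max_starE i0 : (forall i, 0 < k i) -> (forall i, 0 < n i) ->
    (forall i, n i0 * k i <= n i * k i0) ->
  n i0 * max_star n k = k i0 * #|layers n k setT|.
Proof.
move=> k0 n0 min_i0; rewrite card_layers.
have -> : \prod_(i in [set: 'I_p]) 'C(n i, k i) = \prod_(i < p) 'C(n i, k i).
  by apply: eq_bigl => i; rewrite inE.
pose t i := 'C(n i - 1, k i - 1) * \prod_(j < p | j != i) 'C(n j, k j).
have t_eq i : n i * t i = k i * \prod_(i < p) 'C(n i, k i).
  rewrite (bigD1 i) //= !mulnA !subn1; congr (_ * _).
  by rewrite -[in n i](prednK (n0 i)) mul_bin_diag !prednK.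
have t_le i : n i0 * t i <= k i0 * \prod_(i < p) 'C(n i, k i).
  rewrite -(leq_pmul2l (n0 i)) mulnCA t_eq !mulnA leq_mul2r min_i0 orbT //.
rewrite -t_eq; apply/eqP; rewrite eqn_pmul2l // eqn_leq.
rewrite (leq_bigmax (F := t)) andbT; apply/bigmax_leqP=> i _.
by rewrite -(leq_pmul2l (n0 i0)) t_eq t_le.
Qed.

End Products.

(** * Complementary pairs *)

Lemma enum_val_image (T : finType) (C : {set T}) :
  [set enum_val i | i : 'I_#|C|] = C.
Proof.
apply/setP=> D; apply/imsetP/idP => [[i _ ->]|DC]; first exact: enum_valP.
by exists (enum_rank_in DC D); rewrite ?enum_rankK_in.
Qed.

Section Pairs.

Context {p : nat} (n k : 'I_p -> nat) (S : {set 'I_p}).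
Hypothesis S_half : forall i, i \in S -> n i = 2 * k i.
Implicit Types (A B D : {set ground n}) (C E : {set {set ground n}}).
Local Notation F := (layers n k S).
Local Notation cp := (@compl_in p n S).

Lemma part_compl_in D i : part (cp D) i = if i \in S then ~: part D i else set0.
Proof. by apply/setP=> x; rewrite !inE /=; case: (i \in S); rewrite !inE. Qed.

Lemma compl_in_layers D : D \in F -> cp D \in F.
Proof.
move=> /layersP DF; apply/layersP=> i; rewrite part_compl_in.
case: ifP => iS; last exact: cards0.
by rewrite cardsCs setCK card_ord DF iS S_half //; lia.
Qed.

Lemma compl_inK D : D \in F -> cp (cp D) = D.
Proof.
move=> DF; apply: part_inj => i; rewrite !part_compl_in.
by case: ifP => iS; rewrite ?iS ?setCK // (layers_part0 DF) ?iS.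
Qed.

Lemma compl_in_disjoint D : D :&: cp D = set0.
Proof. by apply/setP=> u; rewrite !inE andbCA andbN andbF. Qed.

(** In a part with n i = 2 k i, the only set of size k i that avoids D is
    its complement. *)
Lemma disjoint_compl_in D D' : D \in F -> D' \in F -> D :&: D' = set0 -> D' = cp D.
Proof.
move=> DF D'F DD'; apply: part_inj => i; rewrite part_compl_in.
case: ifP => iS; last by rewrite (layers_part0 D'F) ?iS.
apply/eqP; rewrite eqEcard; apply/andP; split.
  by rewrite -disjoints_subset -setI_eq0 setIC (partI0 i DD').
move/layersP: DF => DF; move/layersP: D'F => D'F.
by rewrite cardsCs setCK card_ord DF D'F iS S_half //; lia.
Qed.

Lemma mem_nbhd C D : C \subset F ->
  (D \in disj_nbhd F C) = (D \in F) && (cp D \in C).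
Proof.
move=> CF; rewrite inE; case DF: (D \in F) => //=.
apply/exists_inP/idP => [[B BC /eqP BD]|DC].
  have BF := subsetP CF _ BC.
  by rewrite (disjoint_compl_in BF DF BD) compl_inK.
by exists (cp D); rewrite // setIC compl_in_disjoint.
Qed.

Lemma nbhd_imset C : C \subset F -> disj_nbhd F C = cp @: C.
Proof.
move=> CF; apply/setP=> D; rewrite mem_nbhd //.
apply/andP/imsetP => [[DF DC]|[B BC ->]]; first by exists (cp D); rewrite ?compl_inK.
by have BF := subsetP CF _ BC; rewrite compl_in_layers ?compl_inK.
Qed.

Lemma card_compl_imset C : C \subset F -> #|cp @: C| = #|C|.
Proof.
move=> CF; apply: card_in_imset => D D' DC D'C eqDD'.
by rewrite -(compl_inK (subsetP CF _ DC)) eqDD' compl_inK ?(subsetP CF).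
Qed.

Lemma compl_in_neq D : (forall i, 0 < n i) -> S != set0 -> D != cp D.
Proof.
move=> n_gt0 /set0Pn[s sS].
apply/eqP=> /setP/(_ (Tagged (fun j => 'I_(n j)) (Ordinal (n_gt0 s)))).
by rewrite !inE /= sS /=; case: (_ \in D).
Qed.

End Pairs.

Section PairedConfig.

Context {p : nat} (n k : 'I_p -> nat).
Hypotheses (n_gt0 : forall i, 0 < n i) (k_gt0 : forall i, 0 < k i).

Lemma part_ratio2E i : (part_ratio n k i == 2%:R%R) = (n i == 2 * k i).
Proof.
rewrite /part_ratio -[RHS](eqr_nat rat) natrM.
have k0 : ((k i)%:R != 0 :> rat)%R by rewrite pnatr_eq0 -lt0n.
apply/eqP/eqP => [<-|->]; first by rewrite divfK.
by rewrite mulfK.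
Qed.

(** The members of E and their complements are 2 #|E| sets, and likewise for
    E', so the factors of B1 and B2 on S have total size 2 w + 2 v = #|F|;
    the factor on the other parts multiplies this to the size of the layer. *)
Lemma paired_config_sum (B1 B2 : {set {set ground n}}) :
  paired_config k B1 B2 -> #|B1| + #|B2| = #|layers n k setT|.
Proof.
case=> S [S0 /subsetP S_ratio]; set F := layers n k S; set R := layers n k (~: S).
have S_half i : i \in S -> n i = 2 * k i.
  by move/S_ratio; rewrite inE part_ratio2E => /eqP.
case=> A [E [E' [[AF EF EF'] [D1 [AE ->] ->] [D2 [AE' ->] ->]]]].
case=> w [v [a [e [[ainj Aa] _ [einj [EE' eE] _] vw [e_neq e_disj _]]]]].
pose cp := @compl_in p n S.
have e_cp i j : e i != cp (e j).
  have [->|ij] := eqVneq i j; first exact: e_neq.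
  apply: contraTneq (e_disj i j ij) => eij; apply/pred0Pn; exists (e i).
  by rewrite !inE eqxx /= {2}eij eqxx orbT.
have no_self (C : {set {set ground n}}) :
    C \subset F -> C \subset E :|: E' -> [disjoint C & disj_nbhd F C].
  move=> CF; rewrite -eE => /subsetP Ce; rewrite (nbhd_imset S_half CF) disjoint_subset.
  apply/subsetP=> D DC; apply/imsetP=> [[D' D'C eqD]].
  have /imsetP[i _ Di] := Ce _ DC; have /imsetP[j _ Dj] := Ce _ D'C.
  by have := e_cp i j; rewrite -Di -Dj eqD eqxx.
have cardU (C1 C2 : {set {set ground n}}) :
    [disjoint C1 & C2] -> #|C1 :|: C2| = #|C1| + #|C2|.
  by move=> C12; apply/eqP; rewrite (leq_card_setU C1 C2).2.
have cardE2 (C : {set {set ground n}}) :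
    C \subset F -> C \subset E :|: E' -> #|C :|: disj_nbhd F C| = 2 * #|C|.
  move=> CF CE; rewrite cardU ?no_self // nbhd_imset // (card_compl_imset CF).
  by rewrite mul2n addnn.
have nbF (C : {set {set ground n}}) : disj_nbhd F C \subset F.
  by apply/subsetP=> D; rewrite inE => /andP[].
rewrite !card_fam_prod ?subUset ?AF ?EF ?EF' ?nbF // -mulnDl.
rewrite (cardU _ _ AE) (cardU _ _ AE') !cardE2 ?subsetUl ?subsetUr //.
rewrite -(fam_prod_layers n k S) card_fam_prod //; congr (_ * _).
rewrite card_layers -vw Aa card_imset // card_ord.
have : #|E :|: E'| = v by rewrite -eE card_imset // card_ord.
by rewrite cardU // => <-; rewrite addnACA addnn -mul2n -!mulnDr [in RHS]addnC.
Qed.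

(** Sort the complementary pairs of F by the number of their members in C.
    The pairs with one member in C give the family A, which C and C2 share;
    those with two members lie in C only, and those with none lie in C2
    only. Choosing one member from each of the latter pairs gives E and E'. *)
Lemma paired_config_of_halves (S : {set 'I_p}) (C C2 : {set {set ground n}}) :
    let F := layers n k S in let R := layers n k (~: S) in
    S != set0 -> (forall i, i \in S -> n i = 2 * k i) ->
    C \subset F -> C2 = [set D in F | compl_in S D \notin C] -> C != C2 ->
  paired_config k (fam_prod C R) (fam_prod C2 R).
Proof.
move=> F R S0 S_half CF C2E CC2; exists S; split=> //.
  by apply/subsetP=> i /S_half ni; rewrite inE part_ratio2E ni.
have [s sS] := set0Pn _ S0.
(* The point u0 belongs to exactly one member of each pair, the chosen one. *)
pose u0 : ground n := Tagged (fun j => 'I_(n j)) (Ordinal (n_gt0 s)).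
pose cp := @compl_in p n S.
have cpF D : D \in F -> cp D \in F := @compl_in_layers _ _ _ _ S_half D.
have cpK D : D \in F -> cp (cp D) = D := @compl_inK _ _ _ _ D.
have cpu D : (u0 \in cp D) = (u0 \notin D) by rewrite inE /= sS.
have inF D : D \in C -> D \in F by apply: (subsetP CF).
pose A := [set D in C | cp D \notin C].
pose E := [set D in C | (cp D \in C) && (u0 \in D)].
pose E' := [set D in F | [&& D \notin C, cp D \notin C & u0 \in D]].
have mA D : (D \in A) = (D \in C) && (cp D \notin C) by rewrite in_set.
have mE D : (D \in E) = [&& D \in C, cp D \in C & u0 \in D] by rewrite in_set.
have mE' D : (D \in E') = [&& D \in F, D \notin C, cp D \notin C & u0 \in D].
  by rewrite in_set.
have mC2 D : (D \in C2) = (D \in F) && (cp D \notin C) by rewrite C2E in_set.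
have AF : A \subset F by apply/subsetP=> D /setIdP[/inF].
have EF : E \subset F by apply/subsetP=> D /setIdP[/inF].
have EF' : E' \subset F by apply/subsetP=> D /setIdP[].
have PF : E :|: E' \subset F by rewrite subUset EF.
have nb := @mem_nbhd _ _ _ _ S_half.
have by_cases (P : {set ground n} -> Prop) :
    (forall D, D \in F -> P D) -> (forall D, D \notin F -> P D) -> forall D, P D.
  by move=> PF' PnF D; have [/PF'|/PnF] := boolP (D \in F).
have disjP (C1 C3 : {set {set ground n}}) :
    (forall D, D \in C1 -> D \in C3 -> False) -> [disjoint C1 & C3].
  move=> C13; rewrite -setI_eq0; apply/eqP/setP=> D; rewrite !inE.
  by apply/negP=> /andP[]; apply: C13.
have cnF D : D \notin F -> D \in C = false by move=> DnF; apply: contraNF DnF => /inF.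
have dA : [disjoint A & disj_nbhd F A].
  by apply: disjP => D; rewrite nb // !mA => /andP[DC _] /and3P[DF _]; rewrite cpK // DC.
have dP : [disjoint E :|: E' & disj_nbhd F (E :|: E')].
  apply: disjP => D; rewrite nb // !in_setU !mE !mE' cpu.
  by case: (u0 \in D); rewrite ?andbF.
have cover : (E :|: E') :|: disj_nbhd F (E :|: E') = F :\: (A :|: disj_nbhd F A).
  apply/setP; apply: by_cases => D DF; rewrite !(in_setU, in_setD, nb) // !(mA, mE, mE').
    rewrite DF (cpF _ DF) (cpK _ DF) cpu /=.
    by case: (D \in C); case: (cp D \in C); case: (u0 \in D).
  by rewrite cnF // (negbTE DF) /= ?andbF.
exists A, E, E'; split=> //.
- exists C => //; split.
    apply: disjP => D; rewrite in_setU nb // !(mA, mE, mE') => /andP[DC /negbTE cDC].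
    by rewrite cDC !andbF.
  apply/setP; apply: by_cases => D DF; rewrite !(in_setU, nb) // !(mA, mE, mE').
    rewrite DF (cpK _ DF) cpu /=.
    by case: (D \in C); case: (cp D \in C); case: (u0 \in D).
  by rewrite cnF // (negbTE DF).
- exists C2 => //; split.
    apply: disjP => D; rewrite in_setU nb // !(mA, mE, mE') => /andP[DC _].
    by rewrite DC /= andbF (cpK _ (inF _ DC)) DC !andbF.
  apply/setP; apply: by_cases => D DF; rewrite !(in_setU, nb) // mC2 !(mA, mE, mE').
    rewrite DF (cpF _ DF) (cpK _ DF) cpu /=.
    by case: (D \in C); case: (cp D \in C); case: (u0 \in D).
  by rewrite cnF // (negbTE DF).
have cardU (C1 C3 : {set {set ground n}}) :
    [disjoint C1 & C3] -> #|C1 :|: C3| = #|C1| + #|C3|.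
  by move=> C13; apply/eqP; rewrite (leq_card_setU C1 C3).2.
have cardA : #|A :|: disj_nbhd F A| = 2 * #|A|.
  by rewrite cardU // nbhd_imset // (card_compl_imset AF) mul2n addnn.
have cardP : #|E :|: E' :|: disj_nbhd F (E :|: E')| = 2 * #|E :|: E'|.
  by rewrite cardU // nbhd_imset // (card_compl_imset PF) mul2n addnn.
have DsubF : A :|: disj_nbhd F A \subset F.
  by rewrite subUset AF; apply/subsetP=> D; rewrite nb // => /andP[].
have inP (j : 'I_#|E :|: E'|) : enum_val j \in F.
  by apply: (subsetP PF); apply: enum_valP.
have u0P (j : 'I_#|E :|: E'|) : u0 \in enum_val j.
  have := enum_valP j; rewrite in_setU mE mE'.
  by case/orP; [case/and3P | case/and4P].
exists #|A|, #|E :|: E'|, (@enum_val _ (mem A)), (@enum_val _ (mem (E :|: E'))); split.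
- by rewrite enum_val_image; split=> //; apply: enum_val_inj.
- split; last first.
    move=> i j _; apply/eqP=> eqA; have := enum_valP i; have := enum_valP j.
    by rewrite eqA !mA => /andP[_ /negbTE cj]; rewrite cj.
  rewrite -cardA; apply: proper_card; rewrite properEneq DsubF andbT.
  (* If A and its complements filled F, every pair would have exactly one
     member in C, and then C2 would be C. *)
  apply: contraNneq CC2 => AAF; apply/eqP/setP.
  apply: by_cases => D DF; last by rewrite cnF // mC2 (negbTE DF).
  have : D \in A :|: disj_nbhd F A by rewrite AAF.
  rewrite in_setU nb // !mA mC2 DF (cpK _ DF) /=.
  by case: (D \in C); case: (cp D \in C).
- split; first exact: enum_val_inj.
    split; last by rewrite enum_val_image.
    by apply: disjP => D; rewrite mE mE' => /andP[->]; rewrite andbF.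
  have -> : [set compl_in S (enum_val j) | j : 'I_#|E :|: E'|] = disj_nbhd F (E :|: E').
    by rewrite nbhd_imset // -[in RHS](enum_val_image (E :|: E')) -imset_comp.
  split.
    apply: disjP => D; rewrite !nb // mE mE' => /andP[_ /andP[->]].
    by rewrite !andbF.
  by apply/setP=> D; rewrite in_setU !nb // in_setU andb_orr.
- rewrite -card_layers -/F -(cardsID (A :|: disj_nbhd F A) F) (setIidPr DsubF) cardA.
  by rewrite -cover cardP -mulnDr addnC.
split.
- by move=> j; apply: compl_in_neq.
- move=> i j ij; apply: disjP => D; rewrite !in_set2.
  have ne : enum_val i != enum_val j by rewrite (inj_eq enum_val_inj).
  have key (i' j' : 'I_#|E :|: E'|) : enum_val i' <> cp (enum_val j').
    by move=> eqij; have := u0P i'; rewrite eqij cpu u0P.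
  case/orP=> /eqP-> /orP[] /eqP.
  + by apply/eqP.
  + exact: key.
  + by move/esym; apply: key.
  + move=> eqc; case/eqP: ne; rewrite -(cpK _ (inP i)) -(cpK _ (inP j)).
    by congr (cp _).
exists (A :|: disj_nbhd F A); first by split.
rewrite -cover; apply/setP=> D; rewrite in_setU; apply/bigcupP/orP => [[j _]|].
  rewrite in_set2 => /orP[/eqP->|/eqP->]; first by left; apply: enum_valP.
  by right; rewrite nb // -/cp (cpF _ (inP j)) (cpK _ (inP j)) enum_valP.
case=> [DP|]; first by exists (enum_rank_in DP D); rewrite // enum_rankK_in // !inE eqxx.
rewrite nb // => /andP[DF cDP]; exists (enum_rank_in cDP (cp D)) => //.
by rewrite enum_rankK_in // in_set2 -/cp cpK // eqxx orbT.
Qed.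

End PairedConfig.

(** * Cross-intersecting families *)

Section Core.

Context {T : finType} {m : nat} (A : 'I_m -> {set {set T}}).
Hypothesis crossA : cross_intersecting A.

Definition union_fam := \bigcup_(i < m) A i.
(** The core is an intersecting family, and every set that lies in two of
    the families A i belongs to it. *)
Definition core := [set B in union_fam | [forall C in union_fam, B :&: C != set0]].
Definition rim := union_fam :\: core.

Lemma mem_union_fam i B : B \in A i -> B \in union_fam.
Proof. by move=> BA; apply/bigcupP; exists i. Qed.

Lemma core_rim_disjoint : [disjoint core & rim].
Proof.
rewrite -setI_eq0; apply/eqP/setP=> B; rewrite in_setI in_setD in_set0.
by case: (B \in core).
Qed.

Lemma core_meets B C : B \in core -> C \in core :|: rim -> B :&: C != set0.
Proof.
move=> /setIdP[_ /forall_inP meetB]; rewrite !in_setU => CU; apply: meetB.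
by case/orP: CU => [/setIdP[]|/setDP[]].
Qed.

Lemma shared_in_core i j B : i != j -> B \in A i -> B \in A j -> B \in core.
Proof.
move=> ij Bi Bj; apply/setIdP; split; first exact: mem_union_fam Bi.
apply/forall_inP=> C /bigcupP[l _ Cl].
have [il|il] := eqVneq i l; last exact: crossA il _ _ Bi Cl.
by apply: crossA Bj Cl; rewrite -il eq_sym.
Qed.

(** Members of the rim lie in exactly one A i: a set shared by A i and A j
    meets all of A l for each l, since l differs from i or from j. *)
Lemma sum_card_core : \sum_(i < m) #|A i| = \sum_(i < m) #|A i :&: core| + #|rim|.
Proof.
have splitA i : #|A i| = #|A i :&: core| + #|A i :&: rim|.
  rewrite -(cardsID core (A i)); congr (_ + _); apply: eq_card => B.
  rewrite !in_setI !in_setD andbC; case BA: (B \in A i) => //=.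
  by rewrite (mem_union_fam BA) andbT.
rewrite (eq_bigr _ (fun i _ => splitA i)) big_split /=; congr (_ + _).
transitivity (\sum_(i < m) \sum_(B in rim) (B \in A i)).
  apply: eq_bigr => i _; rewrite -big_mkcondr sum1_card /=.
  by apply: eq_card => B; rewrite in_setI andbC.
rewrite exchange_big -sum1_card /=; apply: eq_bigr => B /setDP[/bigcupP[i _ BA] nBI].
rewrite (bigD1 i) //= BA big1 ?addn0 // => j ji; case BAj: (B \in A j) => //.
by case/negP: nBI; apply: shared_in_core ji BAj BA.
Qed.

Lemma sum_card_core_le : \sum_(i < m) #|A i| <= m * #|core| + #|rim|.
Proof.
rewrite sum_card_core leq_add2r -[m in leqRHS]card_ord -sum_nat_const.
by apply: leq_sum => i _; apply: subset_leq_card; apply: subsetIr.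
Qed.

Lemma all_core : rim = set0 -> \sum_(i < m) #|A i| = m * #|core| ->
  forall i, A i = core.
Proof.
move=> rim0 sumA i.
have sub j : A j \subset core.
  apply/subsetP=> B BA; apply/negPn/negP=> nBI.
  by have := in_set0 B; rewrite -rim0 in_setD nBI (mem_union_fam BA).
have := leqif_sum (P := predT) (fun j _ => subset_leqif_cards (sub j)).
rewrite sum_nat_const card_ord sumA => [[_]]; rewrite eqxx => /esym/forallP/(_ i).
by move/eqP.
Qed.

End Core.

(** * Extremal configurations *)

Section Extremal.

Context {p : nat} (n k : 'I_p -> nat).
Hypotheses (k_gt0 : forall i, 0 < k i) (le2kn : forall i, 2 * k i <= n i).
Variable i0 : 'I_p.
Hypothesis min_i0 : forall i, n i0 * k i <= n i * k i0.
Local Notation layer := (layers n k setT).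
Local Notation N := (n i0).
Local Notation K := (k i0).

Let n_gt0 i : 0 < n i.
Proof. by have := le2kn i; have := k_gt0 i; lia. Qed.

Let layer_gt0 : 0 < #|layer|.
Proof. by have [B BX] := layer_nonempty le2kn; apply/card_gt0P; exists B. Qed.

Lemma intersecting_bound (I : {set {set ground n}}) :
  I \subset layer -> intersecting I -> N * #|I| <= K * #|layer|.
Proof.
move=> IX Iint.
have := @weighted_bound _ _ _ k_gt0 le2kn _ min_i0 set0 I (sub0set _) IX.
rewrite cards0 muln0 add0n; apply; first by move=> B C BI; rewrite setU0; apply: Iint.
by rewrite disjoint_sym -setI_eq0 set0I.
Qed.

Lemma max_intersecting_card (I : {set {set ground n}}) :
    I \subset layer -> intersecting I ->
  max_intersecting layer I <-> N * #|I| = K * #|layer|.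
Proof.
move=> IX Iint; split=> [[_ _ Imax]|cardI].
  have [J [JX Jint cardJ]] := star_family k_gt0 le2kn i0.
  apply/eqP; rewrite eqn_leq intersecting_bound //= -cardJ leq_mul2l Imax ?orbT //.
split=> // J JX Jint.
by rewrite -(leq_pmul2l (n_gt0 i0)) cardI intersecting_bound.
Qed.

(** When 2 K < N every part has n i > 2 k i, so the disjointness graph on
    the layer is connected. *)
Lemma two_step_closed_all (W : {set {set ground n}}) B : 2 * K < N ->
    W \subset layer ->
    (forall C D, C \in W -> D \in layer -> C :&: D = set0 -> D \in W) ->
    B \in W ->
  W = layer.
Proof.
move=> KN WX closedW BW; apply/eqP; rewrite eqEsubset WX; apply/subsetP=> C CX.
apply: (two_step_closed le2kn WX _ BW CX) => [D D' D'' DW D'X D''X DD' D'D''|i ni].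
  by apply: (closedW D') => //; apply: (closedW D).
exfalso; have := min_i0 i; rewrite ni mulnAC leq_mul2r leqNgt KN orbF.
by rewrite eqn0Ngt k_gt0.
Qed.

Variables (m : nat) (m_gt0 : 0 < m) (A : 'I_m -> {set {set ground n}}).
Hypotheses (AX : forall i, A i \subset layer) (crossA : cross_intersecting A).
Local Notation i1 := (Ordinal m_gt0).
Local Notation sigma := (\sum_(i < m) #|A i|).
Local Notation I := (core A).
Local Notation Y := (rim A).

Let UX : union_fam A \subset layer.
Proof. by apply/bigcupsP. Qed.

Let IX : I \subset layer.
Proof. by apply: subset_trans UX; apply/subsetP=> B /setIdP[]. Qed.

Let YX : Y \subset layer.
Proof. by apply: subset_trans UX; apply: subsetDl. Qed.

Let I_meets : meets I (I :|: Y).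
Proof. by move=> B C; apply: core_meets. Qed.

Let I_int : intersecting I.
Proof. by move=> B C BI CI; apply: core_meets BI _; rewrite in_setU CI. Qed.

Let weight : K * #|Y| + N * #|I| <= K * #|layer|.
Proof. exact: weighted_bound min_i0 _ _ YX IX I_meets (core_rim_disjoint A). Qed.

Let sum_le : sigma <= m * #|I| + #|Y| := sum_card_core_le crossA.

(** The sum is at most #|Y| + m * #|I|; replacing m by the larger N / K
    turns this into the weighted bound. *)
Lemma sum_bound_small : m * K <= N -> K * sigma <= K * #|layer|.
Proof.
move=> mKN; apply: leq_trans weight; apply: leq_trans (leq_mul (leqnn K) sum_le) _.
by rewrite mulnDr addnC leq_add2l mulnA leq_mul2r mulnC mKN orbT.
Qed.

(** Multiply the weighted bound by m and use m * K >= N on the term of Y. *)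
Lemma sum_bound_large : N <= m * K -> N * sigma <= m * K * #|layer|.
Proof.
move=> NmK; apply: leq_trans (leq_mul (leqnn N) sum_le) _.
rewrite -mulnA; apply: leq_trans (leq_mul (leqnn m) weight).
rewrite !mulnDr addnC; apply: leq_add; last by rewrite mulnCA.
by rewrite mulnA leq_mul2r NmK orbT.
Qed.

Definition first_full := A i1 = layer /\ (forall i, i != i1 -> A i = set0).
Definition all_max := exists J, max_intersecting layer J /\ (forall i, A i = J).

Lemma first_full_of_layer : A i1 = layer -> first_full.
Proof.
move=> A1; split=> // i ii1; apply/setP=> B; rewrite in_set0; apply/negP=> BA.
have [C CX BC] := layer_disjoint_partner le2kn (subsetP (AX i) _ BA).
by have := crossA ii1 BA (_ : C \in A i1); rewrite A1 BC eqxx => /(_ CX).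
Qed.

Lemma first_full_sum : first_full -> sigma = #|layer|.
Proof.
case=> A1 A0; rewrite (bigD1 i1) //= A1 big1 ?addn0 // => i /A0->.
exact: cards0.
Qed.

Lemma all_max_sum : all_max -> N * sigma = m * K * #|layer|.
Proof.
case=> J [Jmax AJ]; have [JX Jint _] := Jmax.
have /max_intersecting_card cardJ := Jint.
under eq_bigr => i _ do rewrite AJ.
rewrite sum_nat_const card_ord.
by rewrite mulnCA (cardJ JX).1 // mulnA.
Qed.

Lemma all_max_of_rim0 : N <= m * K -> Y = set0 -> N * sigma = m * K * #|layer| -> all_max.
Proof.
move=> NmK Y0 sumA; have cardI : N * #|I| = K * #|layer|.
  apply/eqP; rewrite eqn_leq intersecting_bound //= -(leq_pmul2l m_gt0) mulnA -sumA.
  by rewrite mulnCA leq_mul2l; have := sum_le; rewrite Y0 cards0 addn0 => ->; rewrite orbT.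
exists I; split; first exact/max_intersecting_card.
apply: all_core => //; apply/eqP; rewrite -(eqn_pmul2l (n_gt0 i0)) sumA.
by rewrite mulnCA cardI mulnA.
Qed.

(** The slack N < m * K acts on the term of Y, which must vanish; then every
    A i is the core. *)
Lemma large_equality : N < m * K -> N * sigma = m * K * #|layer| -> all_max.
Proof.
move=> NmK sumA; apply: all_max_of_rim0 => //; first exact: ltnW.
apply/eqP; rewrite -cards_eq0 -leqn0 leqNgt; apply/negP=> Y0.
have := leq_mul (leqnn N) sum_le; rewrite sumA; have := leq_mul (leqnn m) weight.
by have := leq_mul NmK (leqnn #|Y|); nia.
Qed.

Hypothesis A1_neq0 : A (Ordinal m_gt0) != set0.

(** If the core is empty, disjoint members of the layer lie in the same A i,
    so connectivity puts the whole layer into A i1. For m = 1 the union of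
    the families is A i1 itself. *)
Lemma first_full_of_rim : m = 1 \/ 2 * K < N -> Y = layer -> first_full.
Proof.
move=> mKN Yfull; apply: first_full_of_layer.
have Ufull : union_fam A = layer.
  by apply/eqP; rewrite eqEsubset UX -Yfull subsetDl.
case: mKN => [m1|KN].
  rewrite -Ufull; apply/setP=> B; apply/idP/bigcupP => [BA|[i _]]; first by exists i1.
  by congr (B \in A _); apply: val_inj => /=; have := ltn_ord i; rewrite {2}m1; case: (val i).
have [B BA] := set0Pn _ A1_neq0.
apply: (two_step_closed_all KN (AX i1) _ BA) => C D CA DX CD.
move: DX; rewrite -{1}Ufull => /bigcupP[j _ DA].
have [->//|ji1] := eqVneq i1 j.
by have := crossA ji1 CA DA; rewrite CD eqxx.
Qed.

(** The slack m * K < N acts on the term of I, which must vanish; then Y is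
    the whole layer. *)
Lemma small_equality : m * K < N -> sigma = #|layer| -> first_full.
Proof.
move=> mKN sumA; have I0 : #|I| = 0.
  apply/eqP; rewrite -leqn0 leqNgt; apply/negP=> I0.
  have := leq_trans (leq_mul (leqnn K) sum_le) _; rewrite sumA.
  move=> /(_ (K * #|layer|).-1); have := weight; have := leq_mul mKN (leqnn #|I|).
  have := k_gt0 i0; have := layer_gt0; nia.
apply: first_full_of_rim.
  by case: (m) m_gt0 mKN => [//|[|m']] _ mKN; [left | right; nia].
apply/eqP; rewrite eqEcard YX -sumA.
by have := sum_le; rewrite I0 muln0.
Qed.

(** With no slack left, the weighted bound itself is tight. As 2 K < N, the
    rim is closed under disjointness, hence empty or the whole layer. *)
Lemma middle_equality : m * K = N -> 2 < m -> sigma = #|layer| -> first_full \/ all_max.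
Proof.
move=> mKN m2 sumA.
have KN : 2 * K < N by rewrite -mKN ltn_pmul2r.
have eqw : K * #|Y| + N * #|I| = K * #|layer|.
  apply/eqP; rewrite eqn_leq weight -sumA /= -mKN [m * K]mulnC -mulnA -mulnDr leq_mul2l.
  by rewrite addnC sum_le orbT.
have closedY := weighted_eq_closed k_gt0 le2kn min_i0 YX IX I_meets (core_rim_disjoint A) KN eqw.
have [Y0|[B BY]] := set_0Vmem Y.
  right; apply: all_max_of_rim0; rewrite ?mKN //.
  by rewrite sumA.
left; apply: first_full_of_rim; first by right.
by apply: (two_step_closed_all KN YX _ BY) => C D; apply: closedY.
Qed.

End Extremal.

Section Halves.

Context {p : nat} (n k : 'I_p -> nat).
Hypotheses (k_gt0 : forall i, 0 < k i) (le2kn : forall i, 2 * k i <= n i).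
Variable i0 : 'I_p.
Hypothesis half_i0 : n i0 = 2 * k i0.
Local Notation layer := (layers n k setT).

(** Tightness of the bound for two families says that B is in A1 exactly
    when the sets disjoint from B are outside A2. So A1 is closed under two
    disjointness steps, and by connectivity membership in A1 or A2 depends
    only on the trace on the parts S with n i = 2 k i. On these parts
    disjointness is complementation, so the trace C2 of A2 consists of the D
    whose complement is not in the trace C of A1. *)
Lemma half_equality (A1 A2 : {set {set ground n}}) :
    A1 \subset layer -> A2 \subset layer -> meets A1 A2 ->
    #|A1| + #|A2| = #|layer| -> A1 != A2 ->
  paired_config k A1 A2.
Proof.
move=> A1X A2X meetA sumA A12.
have n_gt0 i : 0 < n i by have := le2kn i; have := k_gt0 i; lia.
have min_i0 i : n i0 * k i <= n i * k i0.
  by rewrite half_i0 mulnAC leq_mul2r le2kn orbT.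
have [_] := cross_pair_bound k_gt0 le2kn min_i0 A1X A2X meetA half_i0.
rewrite sumA eqxx => /esym/forall_inP eqA.
have dual B C : B \in layer -> C \in layer -> B :&: C = set0 -> (B \in A1) = (C \notin A2).
  by move=> BX CX BC; have := forall_inP (eqA _ BX) _ CX; rewrite BC eqxx => /eqP.
pose S := [set s | n s == 2 * k s].
have S_half i : i \in S -> n i = 2 * k i by rewrite in_set => /eqP.
have S0 : S != set0 by apply/set0Pn; exists i0; rewrite in_set half_i0.
pose F := layers n k S; pose R := layers n k (~: S).
have same_part B C : B \in layer -> C \in layer ->
    restrict S B = restrict S C -> (B \in A1) = (C \in A1).
  have closed B1 B2 B3 : B1 \in A1 -> B2 \in layer -> B3 \in layer ->
      B1 :&: B2 = set0 -> B2 :&: B3 = set0 -> B3 \in A1.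
    move=> B1A B2X B3X B12 B23; have B1X := subsetP A1X _ B1A.
    by rewrite (dual _ _ B3X B2X) 1?setIC // -(dual _ _ B1X B2X).
  have parts (D E : {set ground n}) i : restrict S D = restrict S E -> n i = 2 * k i -> part D i = part E i.
    move=> /setP DE ni; apply/setP=> x; rewrite !in_part.
    by have := DE (Tagged (fun j => 'I_(n j)) x); rewrite !in_set /= ni eqxx !andbT.
  move=> BX CX BC; apply/idP/idP => [BA|CA].
    by apply: (two_step_closed le2kn A1X closed BA CX) => i; apply: parts.
  by apply: (two_step_closed le2kn A1X closed CA BX) => i; apply: parts.
(* Membership does not depend on the part outside S: any fixed B0 there
   detects the trace. *)
have [i _|B0 B0R _] := exists_disjoint (k := k) (S := ~: S) (U := set0 : {set ground n}).
  by rewrite part0 cards0; have := le2kn i; lia.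
pose C := [set D in F | D :|: B0 \in A1].
pose C2 := [set D in F | compl_in S D \notin C].
have CF : C \subset F by apply/subsetP=> D /setIdP[].
have C2F : C2 \subset F by apply/subsetP=> D /setIdP[].
have A1_mem D B : D \in F -> B \in R -> (D :|: B \in A1) = (D \in C).
  move=> DF BR; rewrite in_set DF /=.
  by apply: same_part; rewrite ?(layersU DF) ?(restrictU DF).
have A2_mem D B : D \in F -> B \in R -> (D :|: B \in A2) = (D \in C2).
  move=> DF BR; rewrite in_set DF /=.
  have [i iS|B' B'R BB'] := exists_disjoint (k := k) (S := ~: S) (U := B).
    by have /layersP/(_ i)-> := BR; rewrite iS addnn -mul2n.
  have cDF := compl_in_layers S_half DF.
  rewrite -(A1_mem _ B' cDF B'R) (dual _ (D :|: B)) ?(layersU DF) ?(layersU cDF) ?negbK //.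
  apply/setP=> u; rewrite in_setI !in_setU in_set0; apply/negP.
  case/andP=> /orP[ucD|uB'] /orP[uD|uB].
  - by have := in_set0 u; rewrite -(compl_in_disjoint S D) in_setI uD ucD.
  - by have := layers_tag BR uB; rewrite in_setC (layers_tag cDF ucD).
  - by have := layers_tag B'R uB'; rewrite in_setC (layers_tag DF uD).
  - by have := in_set0 u; rewrite -BB' in_setI uB uB'.
have prodE (W V : {set {set ground n}}) : V \subset F -> W \subset layer ->
    (forall D B, D \in F -> B \in R -> (D :|: B \in W) = (D \in V)) -> W = fam_prod V R.
  move=> VF WX WV; apply/setP=> B; have [BX|BX] := boolP (B \in layer).
    have DF := restrict_layers S BX; have BR := restrict_layers (~: S) BX.
    by rewrite -(restrictUC S B) WV // mem_fam_prod.
  rewrite (contraNF (subsetP WX B) BX); apply/esym; apply: contraNF BX.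
  by case/imset2P=> D E DV ER ->; apply: layersU (subsetP VF _ DV) ER.
have A1E := prodE _ _ CF A1X A1_mem; have A2E := prodE _ _ C2F A2X A2_mem.
rewrite A1E A2E; apply: paired_config_of_halves => //.
by apply: contraNneq A12 => CC; rewrite A1E A2E CC.
Qed.

End Halves.

(** * The theorem *)

Lemma min_ratio_attained (p : nat) (hp : 0 < p) (n k : 'I_p -> nat) :
    (forall i, 0 < k i) ->
  exists2 i0, min_ratio n k hp = part_ratio n k i0 &
              forall i, n i0 * k i <= n i * k i0.
Proof.
move=> k_gt0; have k0 i : (0 < (k i)%:R :> rat)%R by rewrite ltr0n.
have [i0 mu_i0] : exists i0, min_ratio n k hp = part_ratio n k i0.
  apply: (big_ind (fun x => exists i, x = part_ratio n k i)) => [|x y|i _].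
  - by exists (Ordinal hp).
  - by move=> [i ->] [j ->]; rewrite /Order.min; case: ifP => _; [exists i | exists j].
  - by exists i.
exists i0 => // i.
have : (min_ratio n k hp <= part_ratio n k i)%R by apply: bigmin_le.
by rewrite mu_i0 /part_ratio ler_pdivrMr // mulrAC ler_pdivlMr // -!natrM ler_nat.
Qed.

Theorem theorem1p4 (p : nat) (hp : 0 < p) (n k : 'I_p -> nat)
    (hn : forall i, 0 < n i) (hk : forall i, 0 < k i)
    (hnk : forall i, 2 * k i <= n i)
    (m : nat) (hm : 0 < m) (A : 'I_m -> {set {set ground n}})
    (hX : forall i, A i \subset layers n k setT)
    (hcross : cross_intersecting A)
    (hA1 : A (Ordinal hm) != set0) :
  let X := layers n k setT in
  let mu := min_ratio n k hp in
  let M := max_star n k in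
  let sigma := \sum_(i < m) #|A i| in
  let first_full :=
    A (Ordinal hm) = X /\ (forall i, i != Ordinal hm -> A i = set0) in
  let all_max := exists I, max_intersecting X I /\ (forall i, A i = I) in
  [/\ (m%:R <= mu)%R -> sigma <= #|X|,
      (mu <= m%:R)%R -> sigma <= m * M &
      (((m%:R <= mu)%R -> sigma = #|X|) /\ ((mu <= m%:R)%R -> sigma = m * M))
      <->
      [\/ (m%:R < mu)%R /\ first_full,
          (mu < m%:R)%R /\ all_max |
          m%:R%R = mu /\
          [\/ first_full, all_max |
              exists hm2 : 1 < m,
                paired_config k (A (Ordinal hm)) (A (Ordinal hm2))]]].
Proof.
move=> X mu M sigma ff am.
have [i0 mu_i0 min_i0] := min_ratio_attained hp n hk.
have k0 : (0 < (k i0)%:R :> rat)%R by rewrite ltr0n.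
have le_m_mu : (m%:R <= mu)%R = (m * k i0 <= n i0).
  by rewrite /mu mu_i0 /part_ratio ler_pdivlMr // -natrM ler_nat.
have le_mu_m : (mu <= m%:R)%R = (n i0 <= m * k i0).
  by rewrite /mu mu_i0 /part_ratio ler_pdivrMr // -natrM ler_nat.
have M_eq : n i0 * (m * M) = m * k i0 * #|X|.
  by rewrite mulnCA (max_starE hk hn min_i0) mulnA.
have sumM : sigma = m * M <-> n i0 * sigma = m * k i0 * #|X|.
  rewrite -M_eq; split=> [->//|/eqP].
  by rewrite eqn_pmul2l // => /eqP.
have eqXM : m * k i0 = n i0 -> #|X| = m * M.
  by move=> e; apply/eqP; rewrite -(eqn_pmul2l (hn i0)) M_eq e.
rewrite !ltNge le_m_mu le_mu_m -!ltnNge.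
have eq_m_mu : (m%:R%R = mu) <-> (m * k i0 = n i0).
  split=> [e|e]; apply/eqP; first by rewrite eqn_leq -le_m_mu -le_mu_m e lexx.
  by rewrite eq_le le_m_mu le_mu_m e leqnn.
split.
- move=> le; rewrite -(leq_pmul2l (hk i0)).
  exact: (sum_bound_small hk hnk min_i0 hX hcross).
- move=> le; rewrite -(leq_pmul2l (hn i0)) M_eq.
  exact: (sum_bound_large hk hnk min_i0 hX hcross).
split.
  case: (ltngtP (m * k i0) (n i0)) => [lt|gt|eq] [eqX eqM].
  - constructor 1; split=> //.
    by apply: (small_equality hk hnk min_i0 hX hcross hA1 lt); apply: eqX.
  - constructor 2; split=> //.
    by apply: (large_equality hk hnk min_i0 hm hX hcross gt); apply/sumM/eqM.
  constructor 3; split; first exact/eq_m_mu.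
  have sumX : sigma = #|X| by apply: eqX.
  have [m2|m2] := ltnP 2 m.
    have [?|?] := middle_equality hk hnk min_i0 hX hcross hA1 eq m2 sumX.
      by constructor 1.
    by constructor 2.
  have {m2} m2 : m = 2.
    apply/eqP; rewrite eqn_leq m2 -(leq_pmul2r (hk i0)) eq; exact: hnk.
  subst m.
  have hm2 : 1 < 2 by [].
  have meet01 : meets (A (Ordinal hm)) (A (Ordinal hm2)).
    by move=> B C; apply: hcross.
  have sum2 : #|A (Ordinal hm)| + #|A (Ordinal hm2)| = #|X|.
    rewrite -sumX /sigma big_ord_recl big_ord1.
    by congr (#|pred_of_set (A _)| + #|pred_of_set (A _)|); apply: val_inj.
  have A_eq i : A i = A (Ordinal hm) \/ A i = A (Ordinal hm2).
    by case: i => [[|[|//]] i2]; [left | right]; congr (A _); apply: val_inj.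
  have [A01|A01] := eqVneq (A (Ordinal hm)) (A (Ordinal hm2)); last first.
    by constructor 3; exists hm2; apply: (half_equality hk hnk (esym eq)).
  constructor 2; exists (A (Ordinal hm)); split; last first.
    by move=> i; case: (A_eq i) => -> //.
  have int0 : intersecting (A (Ordinal hm)) by move=> B C BA CA; apply: meet01; rewrite -?A01.
  apply/(max_intersecting_card hk hnk min_i0) => //.
  by rewrite -eq -sum2 -A01 addnn -mul2n mulnAC mulnC mulnA; lia.
case=> [[lt full]|[gt max]|[/eq_m_mu eq conf]].
- split; first by move=> _; apply: first_full_sum.
  by rewrite leqNgt lt.
- split; first by rewrite leqNgt gt.
  by move=> _; apply/sumM; apply: (all_max_sum hk hnk min_i0).
suff sumX : sigma = #|X| by split=> // _; rewrite sumX eqXM.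
case: conf => [full|max|[hm2 conf]].
- exact: first_full_sum.
- by rewrite (eqXM eq); apply/sumM; apply: (all_max_sum hk hnk min_i0).
have m2 : m = 2.
  case: conf => S [/set0Pn[s sS] /subsetP/(_ _ sS)]; rewrite in_set => /eqP s2 _.
  apply/eqP; rewrite eqn_leq hm2 andbT -(ler_nat rat) -s2.
  have -> : (m%:R = mu :> rat)%R by apply/eqP; rewrite eq_le le_m_mu le_mu_m eq leqnn.
  exact: bigmin_le.
rewrite -(paired_config_sum hk conf); subst m; rewrite /sigma big_ord_recl big_ord1.
by congr (#|pred_of_set (A _)| + #|pred_of_set (A _)|); apply: val_inj.
Qed.
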